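(* Let $q>2$ be even and let $\mathcal{E}$ be a set of solids of $\mathrm{PG}(4,q)$ such that (I) every point of $\mathrm{PG}(4,q)$ lies in either $0$, $\frac12q^3$ or $\frac12(q^3-q^2)$ solids of $\mathcal{E}$, (II) every plane of $\mathrm{PG}(4,q)$ lies in either $0$, $\frac12q$ or $q$ solids of $\mathcal{E}$, and (III) there exists a line of $\mathrm{PG}(4,q)$ that lies in exactly $\frac12q(q+1)$ solids of $\mathcal{E}$. Then $\mathcal{E}$ is the set of solids of $\mathrm{PG}(4,q)$ that meet some non-singular quadric $Q(4,q)$ in an elliptic quadric.
   Context: A solid of $\mathrm{PG}(4,q)$ is a hyperplane (a 3-dimensional projective subspace). $Q(4,q)$ denotes a non-singular quadric of $\mathrm{PG}(4,q)$. *)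

(* Defs.v *)
From HB Require Import structures.
From mathcomp Require Import all_boot all_order all_algebra all_field.
From mathcomp Require Import finmap.

Set Implicit Arguments.
Unset Strict Implicit.
Unset Printing Implicit Defensive.

Import GRing.Theory.
Local Open Scope ring_scope.

(* Projective dimension is one less than vector space dimension. *)
Section ProjectiveSubspaces.

Variables (F : fieldType) (V : vectType F).
Implicit Type U : {vspace V}.

Definition is_point U := \dim U == 1%N.
Definition is_line U := \dim U == 2%N.
Definition is_plane U := \dim U == 3%N.
Definition is_solid U := \dim U == 4%N.

Definition num_through (E : {fset {vspace V}}) U : nat :=
  #|` [fset S in E | (U <= S)%VS]%fset |.

End ProjectiveSubspaces.

Section Quadrics.

Variables (F : fieldType) (V : vectType F).
Implicit Types (Q : V -> F) (S P : {vspace V}).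

Definition polar Q (x y : V) : F := Q (x + y) - Q x - Q y.

(* Linearity of the polar form in one argument suffices, as it is symmetric. *)
Definition quadratic_form Q : Prop :=
  (forall (a : F) (x : V), Q (a *: x) = a ^+ 2 * Q x) /\
  (forall y : V, scalar (fun x => polar Q x y)).

(* The quadric has no singular point. The condition Q x = 0 is not redundant
   in characteristic 2, where the polar form of a non-singular quadratic form
   in an odd number of variables has a one-dimensional radical (the nucleus). *)
Definition nonsingular Q : Prop :=
  forall x : V, Q x = 0 -> (forall y : V, polar Q x y = 0) -> x = 0.

Definition quadric Q P : Prop :=
  is_point P /\ (forall v : V, v \in P -> Q v = 0).

(* In suitable coordinates on S, Q is f(x0, x1) + x2 x3 where
   f = a x0^2 + b x0 x1 + c x1^2 is an irreducible binary quadratic form. The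
   condition a != 0 excludes f = x1 (b x0 + c x1), which is reducible although
   its dehomogenization b X + c is irreducible when b != 0. *)
Definition elliptic_form_on S Q : Prop :=
  exists (e : 4.-tuple V) (a b c : F),
    [/\ basis_of S e, a != 0,
        irreducible_poly (a *: 'X^2 + b *: 'X + c%:P) &
        forall x0 x1 x2 x3 : F,
          Q (x0 *: e`_0 + x1 *: e`_1 + x2 *: e`_2 + x3 *: e`_3) =
          a * x0 ^+ 2 + b * (x0 * x1) + c * x1 ^+ 2 + x2 * x3].

Definition elliptic_quadric_of S (X : {vspace V} -> Prop) : Prop :=
  exists Q : V -> F, elliptic_form_on S Q /\
    (forall P, X P <-> quadric Q P /\ (P <= S)%VS).

Definition meets_in_elliptic_quadric S Q : Prop :=
  elliptic_quadric_of S (fun P => quadric Q P /\ (P <= S)%VS).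

End Quadrics.

(* Main.v *)
Require Import Defs.
From HB Require Import structures.
From mathcomp Require Import all_boot all_order all_algebra all_field.
From mathcomp Require Import all_fingroup all_solvable.
From mathcomp Require Import finmap zify ring.

(** Identify a solid with the vector w (up to a scalar) of which it is the
    orthogonal, and write D for the set of vectors of the solids of E.

    Counting inside subspaces around a fixed element of D shows that the dual
    plane given by (III) is in no dual solid with (q^3 - q^2)/2 elements of E;
    this forces |E| = q^2(q^2 - 1)/2. The first two moments of the number of
    solids of E through a point then give exactly one point <n> on no solid of
    E, the future nucleus. Every line through <n> has a unique other point
    lying on (q^3 - q^2)/2 solids of E. These points are the zeros of a
    function phi with phi(ax) = a phi(x) and phi(x + sn) = phi(x) + s, and it
    remains to see that phi^2 is a quadratic form.

    Double counting translates (I) and (II) into intersection numbers of the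
    zero set of phi: a line has 0, 1, 2 or q + 1 zeros, a plane off <n> has
    1, q + 1 or 2q + 1, a solid of E has q^2 + 1. Say that a and b are
    orthogonal if phi(a + b) = phi(a) + phi(b). The intersection numbers make
    the orthogonal of a a subspace, of dimension 4 unless a is in <n>. In a
    frame e1, e2 orthogonal to e3, e4 with phi(ei) = 0, put
    h(s, t) = phi(s e1 + t e2). Transversals of opposite lines of the
    quadrangle e1 e3 e2 e4 give phi(s e3 + t e4) = h(1, cst), whence
    h(1, s^2) = s h(1, 1) by homogeneity: so phi^2 is
    x0^2 + k x1 x2 + m x3 x4. *)

Set Implicit Arguments.
Unset Strict Implicit.
Unset Printing Implicit Defensive.

Import GRing.Theory.
Local Open Scope ring_scope.

(** * Orthogonality for the standard dot product, and the basic incidence count *)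

Section Dot.

Variables (F : finFieldType) (n : nat).
Notation V := 'rV[F]_n.
Notation q := #|F|.
Implicit Types (x y u w : V) (X Y : {vspace V}).

Definition dot w x : F := \sum_i w 0 i * x 0 i.

Lemma dotC w x : dot w x = dot x w.
Proof. by apply: eq_bigr => i _; rewrite mulrC. Qed.

Lemma dotDr w x y : dot w (x + y) = dot w x + dot w y.
Proof. by rewrite -big_split; apply: eq_bigr => i _; rewrite mxE mulrDr. Qed.

Lemma dotZr w a x : dot w (a *: x) = a * dot w x.
Proof. by rewrite mulr_sumr; apply: eq_bigr => i _; rewrite mxE mulrCA. Qed.

Lemma dotDl w u x : dot (w + u) x = dot w x + dot u x.
Proof. by rewrite dotC dotDr !(dotC x). Qed.

Lemma dotZl a w x : dot (a *: w) x = a * dot w x.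
Proof. by rewrite dotC dotZr dotC. Qed.

Lemma dot0r w : dot w 0 = 0.
Proof. by rewrite -(scale0r 0) dotZr mul0r. Qed.

Lemma dot0l x : dot 0 x = 0.
Proof. by rewrite dotC dot0r. Qed.

Lemma dot_nondeg x : x != 0 -> exists w, dot w x != 0.
Proof.
move=> x0; have [i xi] : exists i, x 0 i != 0.
  apply/existsP; apply: contraNT x0; rewrite negb_exists => /forallP x0.
  by apply/eqP/rowP=> i; rewrite mxE; apply/eqP; move: (x0 i); rewrite negbK.
exists (delta_mx 0 i); rewrite /dot (bigD1 i) //= mxE !eqxx mul1r.
rewrite big1 ?addr0 // => j ji.
by rewrite mxE eqxx (negPf ji) mul0r.
Qed.

(** A member of the span is a linear combination of members of [A], absorbed term by term. This
    turns sets given by a boolean condition into subspaces: [ann] here, [perp] later. *)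
Lemma vspace_closed (A : {set V}) : 0 \in A ->
    (forall a x y, x \in A -> y \in A -> a *: x + y \in A) ->
  <<enum A>>%VS =i A.
Proof.
move=> A0 Acl x; apply/idP/idP; last first.
  by move=> xA; apply: memv_span; rewrite mem_enum.
rewrite -[enum A]/(val (in_tuple (enum A))) => /coord_span ->.
elim/big_rec: _ => // i y _ yA; apply: Acl => //.
by rewrite -mem_enum; apply: mem_nth.
Qed.

Definition ann X : {vspace V} :=
  <<enum [set w : V | [forall x in X, dot w x == 0%R]]>>%VS.

Lemma annP X w : reflect (forall x, x \in X -> dot w x = 0) (w \in ann X).
Proof.
have -> : (w \in ann X) = [forall x in X, dot w x == 0].
  rewrite vspace_closed ?inE //; first by apply/forall_inP=> x _; rewrite dot0l.
  move=> a w1 w2; rewrite !inE => /forall_inP h1 /forall_inP h2.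
  apply/forall_inP=> x xX; rewrite dotDl dotZl.
  by rewrite (eqP (h1 _ xX)) (eqP (h2 _ xX)) mulr0 addr0.
by apply: (iffP forall_inP) => h x xX; apply/eqP; [apply: h | rewrite h].
Qed.

Lemma ann_line w x : (x \in ann <[w]>%VS) = (dot w x == 0).
Proof.
apply/annP/eqP=> [h | h y /vlineP [k ->]]; last by rewrite dotZr dotC h mulr0.
by rewrite dotC h ?memv_line.
Qed.

Lemma q_gt0 : (0 < q)%N. Proof. exact/ltnW/finRing_gt1. Qed.

(** A vector [x1] of [X] with [dot w x1 = 1] splits [X] into the kernel of [dot w] and the line of
    [x1]; without such a vector the kernel is [X]. One equation covers both cases, so that it can be
    summed over [w]. *)
Lemma card_section X w :
  (q * #|[set x in X | dot w x == 0%R]| =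
   #|X| + (w \in ann X) * (q.-1 * #|X|))%N.
Proof.
case: (annP X w) => [h | /annP nh].
  have -> : [set x in X | dot w x == 0] = [set x in X].
    by apply/setP=> x; rewrite !inE; case: (boolP (x \in X)) => //= /h ->; rewrite eqxx.
  by rewrite cardsE mul1n -mulSn prednK // q_gt0.
have [x1 x1X d1] : exists2 x, x \in X & dot w x = 1.
  have [/existsP [x /andP [xX d]] | /existsPn nx] :=
      boolP [exists x, (x \in X) && (dot w x != 0)].
    exists ((dot w x)^-1 *: x); first by rewrite memvZ.
    by rewrite dotZr mulVf.
  case/negP: nh; apply/annP=> x xX; apply/eqP; move: (nx x).
  by rewrite xX negbK.
set K := [set x in X | _].
rewrite addn0 mulnC -(cardsE (mem X)) -cardsT -cardsX.
pose f (z : V * F) := z.1 + z.2 *: x1.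
have finj : {in setX K setT &, injective f}.
  move=> [x s] [y t]; rewrite !inE !andbT /f /= => /andP [_ /eqP dx] /andP [_ /eqP dy] e.
  have := congr1 (dot w) e; rewrite !dotDr !dotZr dx dy d1 !add0r !mulr1 => st.
  by move: e; rewrite st => /addIr ->.
rewrite -(card_in_imset finj); apply/eq_card=> x; rewrite inE.
apply/imsetP/idP=> [[[y t]] | xX].
  by rewrite !inE /= => /andP [/andP [yX _] _] ->; rewrite memvD ?memvZ.
exists (x - dot w x *: x1, dot w x); last by rewrite /f /= subrK.
rewrite !inE /= memvB ?memvZ //=.
by rewrite -scaleNr dotDr dotZr d1 mulr1 subrr eqxx.
Qed.

Variable D : {set V}.

(* With D the dual set of E, this is q - 1 times the number of solids of E
   through <x>. *)
Definition deg x := #|[set w in D | dot w x == 0]|.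
Definition numin Y := #|[set w in D | w \in Y]|.

(** Double count of the pairs of [x] in [X] and [w] in [D] with [dot w x = 0]. The zero vector takes
    part, with degree [#|D|]. *)
Lemma sum_deg X :
  (q * \sum_(x in X) deg x = #|X| * (#|D| + q.-1 * numin (ann X)))%N.
Proof.
have -> : (\sum_(x in X) deg x =
           \sum_(w in D) #|[set x in X | dot w x == 0%R]|)%N.
  under eq_bigr => x _ do rewrite /deg -sum1_card.
  under eq_bigr => x _.
    rewrite (eq_bigl (fun w => (w \in D) && (dot w x == 0))); last by move=> w; rewrite inE.
  over.
  rewrite (exchange_big_dep (mem D)) /=; last by move=> x w _ /andP [].
  apply: eq_bigr => w wD; rewrite -sum1_card; apply: eq_bigl => x.
  by rewrite inE wD.
rewrite big_distrr /=; under eq_bigr => w _ do rewrite card_section.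
rewrite big_split /= sum_nat_const -big_distrl /= -big_mkcondr /=.
have -> : (\sum_(w in D | w \in ann X) 1 = numin (ann X))%N.
  by rewrite /numin -sum1_card; apply: eq_bigl => w; rewrite inE.
by rewrite mulnDr mulnC; congr (_ + _)%N; rewrite mulnCA [RHS]mulnCA; congr (_ * _)%N; rewrite mulnC.
Qed.

End Dot.

(** * Duality between subspaces and their orthogonals *)

Section AnnDim.

Variables (F : finFieldType) (n : nat).
Notation V := 'rV[F]_n.
Notation q := #|F|.
Implicit Types (x y u w : V) (X Y : {vspace V}).

(** The case [D = setT] of [sum_deg]: all degrees are known there, and after cancellation [q.-1]
    times the claim remains. *)
Lemma card_ann X : (#|X| * #|ann X| = #|{: V}|)%N.
Proof.
have := sum_deg setT X.
have -> : numin setT (ann X) = #|ann X|.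
  by rewrite /numin -[RHS]cardsE; apply: eq_card => w; rewrite !inE.
have -> : #|[set: V]| = #|{: V}| by rewrite cardsT.
have h x : (q * deg setT x = #|{: V}| + (x == 0%R) * (q.-1 * #|{: V}|))%N.
  have := card_section (fullv : {vspace V}) x.
  have -> : #|(fullv : {vspace V})| = #|{: V}|.
    by apply: eq_card => w; rewrite memvf.
  have -> : (x \in ann fullv) = (x == 0).
    apply/annP/eqP=> [h | -> y _]; last exact: dot0l.
    apply/eqP; apply/negPn/negP=> /dot_nondeg [w].
    by rewrite dotC h ?memvf ?eqxx.
  move=> <-; congr (_ * _)%N; rewrite /deg; apply: eq_card => w.
  by rewrite !inE memvf dotC.
rewrite big_distrr /=; under eq_bigr => x _ do rewrite h.
rewrite big_split /= sum_nat_const -big_distrl /= -big_mkcondr /=.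
rewrite (big_pred1 (0 : V)); last first.
  by move=> x /=; case: eqP => [->|]; rewrite ?mem0v ?andbF.
rewrite mul1n mulnDr => /addnI; rewrite mulnCA => /eqP.
rewrite eqn_pmul2l; first by move/eqP.
by rewrite -ltnS prednK ?q_gt0 // finRing_gt1.
Qed.

Lemma dim_rV : \dim {: V} = n.
Proof. by rewrite dimvf /dim /= mul1n. Qed.

Lemma dim_ann X : (\dim (ann X) = n - \dim X)%N.
Proof.
have := card_ann X; have -> : #|{: V}| = #|(fullv : {vspace V})|.
  by apply: eq_card => w; rewrite memvf.
rewrite !card_vspace -expnD dim_rV => /eqP.
rewrite eqn_exp2l ?finRing_gt1 // => /eqP h.
by rewrite -[X in (X - _)%N]h addKn.
Qed.

Lemma annK X : ann (ann X) = X.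
Proof.
have dX : (\dim X <= n)%N by rewrite -[X in (_ <= X)%N]dim_rV dimvS ?subvf.
apply/esym/eqP; rewrite eqEdim !dim_ann subKn // leqnn andbT.
by apply/subvP=> x xX; apply/annP=> w /annP h; rewrite dotC h.
Qed.

Lemma annS X Y : (ann X <= ann Y)%VS = (Y <= X)%VS.
Proof.
have h (A B : {vspace V}) : (A <= B)%VS -> (ann B <= ann A)%VS.
  move=> /subvP AB; apply/subvP=> w /annP wB; apply/annP=> x xA.
  exact/wB/AB.
by apply/idP/idP=> [/h | /h //]; rewrite !annK.
Qed.

Lemma sub_ann_line X w : (X <= ann <[w]>)%VS = (w \in ann X).
Proof. by rewrite -[in LHS](annK X) annS. Qed.

End AnnDim.

(** * Adding one vector to a subspace *)

Section AddLine.

Variables (F : fieldType) (V : vectType F).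
Implicit Types (U : {vspace V}) (u v : V).

Lemma memv_add_lineP U u v :
  reflect (exists k, v - k *: u \in U) (v \in U + <[u]>)%VS.
Proof.
apply: (iffP memv_addP) => [[x xU [y /vlineP [k ->]]] -> | [k h]].
  by exists k; rewrite addrK.
by exists (v - k *: u) => //; exists (k *: u); rewrite ?memvZ ?memv_line ?subrK.
Qed.

Lemma add_lineP u v x :
  reflect (exists s t, x = s *: u + t *: v) (x \in <[u]> + <[v]>)%VS.
Proof.
apply: (iffP (memv_add_lineP _ _ _)) => [[t /vlineP [s h]] | [s [t ->]]].
  by exists s, t; rewrite -h subrK.
by exists t; rewrite addrK memvZ ?memv_line.
Qed.

Lemma memv_add_line U u : u \in (U + <[u]>)%VS.
Proof. by apply/memv_add_lineP; exists 1; rewrite scale1r subrr mem0v. Qed.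

Lemma memv_exchange U u v :
  u \notin U -> u \in (U + <[v]>)%VS -> v \in (U + <[u]>)%VS.
Proof.
move=> uU /memv_add_lineP [k h]; have [k0|k0] := eqVneq k 0.
  by move: h; rewrite k0 scale0r subr0 (negPf uU).
apply/memv_add_lineP; exists k^-1.
rewrite -[v in v - _](scalerK k0) -scalerBr memvZ //.
by rewrite -opprB memvN.
Qed.

Lemma dim_add_line U u : u \notin U -> \dim (U + <[u]>) = (\dim U).+1.
Proof.
move=> uU; have u0 : u != 0 by apply: contraNneq uU => ->; apply: mem0v.
rewrite dimv_disjoint_sum ?dim_vline ?u0 ?addn1 //; apply/eqP.
rewrite -subv0; apply/subvP=> x; rewrite memv_cap => /andP [xU /vlineP [k xk]].
have [k0|k0] := eqVneq k 0; first by rewrite xk k0 scale0r mem0v.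
by case/negP: uU; rewrite -[u](scalerK k0) -xk memvZ.
Qed.

Lemma dim_add_line_le U u : (\dim (U + <[u]>) <= (\dim U).+1)%N.
Proof.
have [uU|/dim_add_line->//] := boolP (u \in U).
by rewrite (addv_idPl _) // -memvE.
Qed.

Lemma dim_add_lines u v : u != 0 -> v \notin <[u]>%VS -> \dim (<[u]> + <[v]>) = 2%N.
Proof. by move=> u0 /dim_add_line ->; rewrite dim_vline u0. Qed.

Lemma sub_add_lines U u v : u \in U -> v \in U -> (<[u]> + <[v]> <= U)%VS.
Proof. by move=> uU vU; rewrite subv_add -!memvE uU. Qed.

Lemma ex_notin U1 U2 : (\dim U1 < \dim U2)%N -> exists2 x, x \in U2 & x \notin U1.
Proof.
move=> h; have /subvPn [x x2 x1] : ~~ (U2 <= U1)%VS.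
  by apply: contraTN h => /dimvS; rewrite leqNgt.
by exists x.
Qed.

End AddLine.

(** * The geometry of the zeros of phi *)

Section Geometry.

Variables (F : finFieldType) (n : 'rV[F]_5) (phi : 'rV[F]_5 -> F).
Variable (elliptic : pred 'rV[F]_5).
Notation V := 'rV[F]_5.
Notation q := #|F|.
Implicit Types (a b c x y u v w : V) (X Y : {vspace V}) (s t k : F).

(** Vectors are counted, zero included, so k projective zeros count as 1 + k(q - 1). In the
    hypotheses below, q^2 on a line is a full line and less than 2q means at most two points; 2q^2 -
    q is 2q + 1 points of a plane, and q^3 - q(q - 1) is q^2 + 1 points of a solid. *)
Definition isotropics X := #|[set x in X | phi x == 0]|.

Hypothesis q_gt2 : (2 < q)%N.
Hypothesis phiZ : forall s x, phi (s *: x) = s * phi x.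
Hypothesis phi_shift : forall s x, phi (x + s *: n) = phi x + s.
Hypothesis isotropics_line : forall X, \dim X = 2%N -> n \notin X ->
  isotropics X = (q ^ 2)%N \/ (isotropics X < 2 * q)%N.
Hypothesis isotropics_plane : forall X, \dim X = 3%N -> n \notin X ->
  (isotropics X <= q ^ 2)%N \/ isotropics X = (2 * q ^ 2 - q)%N.
Hypothesis isotropics_elliptic : forall w, elliptic w ->
  isotropics (ann <[w]>) = (q ^ 3 - q * q.-1)%N.
Hypothesis n_elliptic : forall w, elliptic w -> dot w n != 0.
Hypothesis elliptic_line : forall w X, elliptic w -> \dim X = 2%N ->
  (X <= ann <[w]>)%VS -> (isotropics X < 2 * q)%N.
Hypothesis elliptic_exists : forall x, x != 0 -> phi x = 0 ->
  exists2 w, elliptic w & dot w x = 0.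

Lemma phi0 : phi 0 = 0.
Proof. by rewrite -(scale0r 0) phiZ mul0r. Qed.

Lemma phi_n : phi n = 1.
Proof. by rewrite -[n]add0r -[n]scale1r phi_shift phi0 add0r. Qed.

Lemma n_neq0 : n != 0.
Proof. by apply: contra_eq_neq phi_n => ->; rewrite phi0 eq_sym oner_neq0. Qed.

(* Projection from the nucleus onto the zeros of phi. *)
Definition project x := x - phi x *: n.

Lemma phi_project x : phi (project x) = 0.
Proof. by rewrite /project -scaleNr phi_shift subrr. Qed.

(** In characteristic 2 this is the vanishing of the polar form of [phi_form] ([polar_eq0]),
    expressed before [phi_form] is known to be quadratic. *)
Definition orth a b := phi (a + b) == phi a + phi b.

Lemma orthC a b : orth a b = orth b a.
Proof. by rewrite /orth addrC [phi a + _]addrC. Qed.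

(** The shift adds [s] to both sides. Orthogonality thus depends only on classes modulo [n] and can
    be tested on projections, which are zeros of [phi]. *)
Lemma orth_shift a b s : orth a (b + s *: n) = orth a b.
Proof. by rewrite /orth addrA !phi_shift addrA (inj_eq (addIr _)). Qed.

Lemma orth_shiftl a b s : orth (a + s *: n) b = orth a b.
Proof. by rewrite orthC orth_shift orthC. Qed.

Lemma orth_project a b : orth (project a) (project b) = orth a b.
Proof. by rewrite /project -!scaleNr orth_shift orth_shiftl. Qed.

Lemma orthn a s : orth a (s *: n).
Proof. by rewrite -[s *: n]add0r orth_shift /orth addr0 phi0 addr0. Qed.

(** The line carries three distinct points of zeros, and [isotropics_line] allows more than two only
    on a full line. *)
Lemma isotropic_line_full a b : a != 0 -> b \notin <[a]>%VS ->
  phi a = 0 -> phi b = 0 -> phi (a + b) = 0 ->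
  isotropics (<[a]> + <[b]>) = (q ^ 2)%N.
Proof.
move=> a0 ba pa pb pab; set X := (_ + _)%VS.
have indep s t : s *: a + t *: b = 0 -> s = 0 /\ t = 0.
  move=> e; have t0 : t = 0.
    apply/eqP; apply: contraNT ba => t0; apply/vlineP; exists (- (t^-1 * s)).
    apply: (scalerI t0); rewrite scalerA mulrN mulVKf // scaleNr.
    by apply/eqP; rewrite -addr_eq0 addrC e.
  split=> //; apply/eqP; move/eqP: e; rewrite t0 scale0r addr0 scaler_eq0.
  by rewrite (negPf a0) orbF.
have aX : a \in X by rewrite (subvP (addvSl _ _)) ?memv_line.
have bX : b \in X by apply: memv_add_line.
have nX : n \notin X.
  (* If n = sa + tb, then t = 0 gives phi(n) = 0, and t != 0 gives phi(b) = 1/t; both are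
     impossible. *)
  apply/add_lineP=> [[s [t e]]].
  have [t0|t0] := eqVneq t 0.
    have := phi_n; rewrite e t0 scale0r addr0 phiZ pa mulr0 => /eqP.
    by rewrite eq_sym oner_eq0.
  have := pb; rewrite (_ : b = (- (t^-1 * s)) *: a + t^-1 *: n).
    rewrite phi_shift phiZ pa mulr0 add0r => /eqP.
    by rewrite invr_eq0 (negPf t0).
  by rewrite e scalerDr !scalerA mulVf // scale1r addrA -scalerDl addNr scale0r add0r.
have [//|] := isotropics_line (dim_add_lines a0 ba) nX.
rewrite ltnNge; case/negP.
(* This lists 2q distinct zeros: the multiples of [a], the nonzero multiples of [b], and [a + b] in
   the slot that 0 would repeat. *)
pose f (z : F * bool) := if z.2 then z.1 *: a else if z.1 == 0 then a + b else z.1 *: b.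
have inj : injective f.
  have e2 s t s' t' : s *: a + t *: b = s' *: a + t' *: b -> s = s' /\ t = t'.
    move=> e; have [] := indep (s - s') (t - t').
      by rewrite !scalerBl addrACA -opprD e subrr.
    by move=> /eqP; rewrite subr_eq0 => /eqP -> /eqP; rewrite subr_eq0 => /eqP.
  have fE z : f z = (if z.2 then z.1 else if z.1 == 0 then 1 else 0) *: a +
                    (if z.2 then 0 else if z.1 == 0 then 1 else z.1) *: b.
    rewrite /f; case: z => [s [] /=]; first by rewrite scale0r addr0.
    by case: eqP => _; rewrite ?scale1r // scale0r add0r.
  move=> [s i] [t j]; rewrite !fE => /e2 [] /=.
  case: i; case: j => /=.
  - by move=> ->.
  - case: (eqVneq t 0) => [_ _ /esym /eqP|t0 _ /esym /eqP]; first by rewrite oner_eq0.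
    by rewrite (negPf t0).
  - case: (eqVneq s 0) => [_ _ /eqP|s0 _ /eqP]; first by rewrite oner_eq0.
    by rewrite (negPf s0).
  - case: (eqVneq s 0) => [->|s0]; case: (eqVneq t 0) => [->|t0] //.
    + by move=> /eqP; rewrite oner_eq0.
    + by move=> /esym /eqP; rewrite oner_eq0.
    + by move=> _ ->.
have -> : (2 * q)%N = #|[set: F * bool]| by rewrite cardsT card_prod card_bool mulnC.
rewrite -(card_imset _ inj); apply/subset_leq_card/subsetP=> _ /imsetP [[s i] _ ->].
rewrite inE /f /=; case: i; last case: eqP => _.
- by rewrite memvZ //= phiZ pa mulr0.
- by rewrite memvD //= pab.
- by rewrite memvZ //= phiZ pb mulr0.
Qed.

Lemma isotropics_full X x : isotropics X = (q ^ \dim X)%N -> x \in X -> phi x = 0.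
Proof.
rewrite -card_vspace -cardsE => e xX.
have /eqP /setP /(_ x) : [set x in X | phi x == 0] == [set x in X].
  rewrite eqEcard -/(isotropics X) e leqnn andbT.
  by apply/subsetP=> y; rewrite !inE => /andP [].
by rewrite !inE xX => /eqP.
Qed.

(** For the projections of [a] and [b], orthogonality says that their sum is a zero too, so their
    line is full; shifting back along [n] gives the formula. *)
Lemma orth_lin a b s t : orth a b -> phi (s *: a + t *: b) = s * phi a + t * phi b.
Proof.
rewrite -orth_project; suff h : orth (project a) (project b) -> phi (s *: project a + t *: project b) = 0.
  move=> /h; rewrite (_ : s *: project a + t *: project b =
     s *: a + t *: b + (- (s * phi a + t * phi b)) *: n).
    by rewrite phi_shift => /eqP; rewrite subr_eq0 => /eqP.
  by apply/rowP=> i; rewrite !mxE; ring.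
move: (phi_project a) (phi_project b); move: (project a) (project b) => {}a {}b pa pb.
rewrite /orth pa pb addr0 => /eqP pab.
have [->|a0] := eqVneq a 0; first by rewrite scaler0 add0r phiZ pb mulr0.
have [/vlineP [k ->]|ba] := boolP (b \in <[a]>%VS).
  by rewrite scalerA -scalerDl phiZ pa mulr0.
apply: (@isotropics_full (<[a]> + <[b]>)%VS).
  by rewrite dim_add_lines // isotropic_line_full.
by apply/add_lineP; exists s, t.
Qed.

Lemma orthZ a b s t : orth a b -> orth (s *: a) (t *: b).
Proof. by move=> ab; rewrite /orth orth_lin // !phiZ. Qed.

Lemma orthZr a b t : t != 0 -> orth a (t *: b) = orth a b.
Proof.
move=> t0; apply/idP/idP => [/(orthZ 1 t^-1)|/(orthZ 1 t)]; rewrite !scale1r //.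
by rewrite scalerK.
Qed.

Lemma orthZl a b t : t != 0 -> orth (t *: a) b = orth a b.
Proof. by move=> t0; rewrite orthC orthZr // orthC. Qed.

Lemma orth_addl a b s : orth a b -> orth a (s *: a + b).
Proof.
move=> ab; rewrite /orth addrA -{1}[a]scale1r -scalerDl -[b]scale1r !orth_lin //.
by apply/eqP; ring.
Qed.

(** The plane of [a], [b] and the projection [y] of [b + c] contains the full line [L] and one more
    zero, hence has the large intersection number. This forces a nonzero [d] in [L] orthogonal to
    [y]. Either [d] is a multiple of [a], or [b] and [c] turn out to be orthogonal and a triangle of
    full lines remains. *)
Lemma orthD_isotropic a b c :
    phi a = 0 -> phi b = 0 -> phi c = 0 ->
    a \notin <[n]>%VS -> b \notin (<[n]> + <[a]>)%VS ->
    c \notin (<[n]> + <[a]> + <[b]>)%VS ->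
  orth a b -> orth a c -> orth a (b + c).
Proof.
move=> pa pb pc an bn cn ab ac; set f := phi (b + c).
pose y := b + c - f *: n.
have py : phi y = 0 by rewrite /y -scaleNr phi_shift subrr.
have a0 : a != 0 by apply: contraNneq an => ->; apply: mem0v.
have ba : b \notin <[a]>%VS by apply: contraNN bn; apply/subvP/addvSr.
set L := (<[a]> + <[b]>)%VS; set X := (L + <[y]>)%VS.
have dL : \dim L = 2%N by apply: dim_add_lines.
have dX4 : \dim (<[n]> + X) = 4%N.
  have yn : y \notin (<[n]> + <[a]> + <[b]>)%VS.
    apply: contraNN cn => yn.
    have -> : c = y - b + f *: n by apply/rowP=> i; rewrite !mxE; ring.
    apply: memvD; first by apply: memvB => //; apply: memv_add_line.
    apply: memvZ.
    by rewrite -addvA (subvP (addvSl _ _)) ?memv_line.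
  by rewrite !addvA !dim_add_line // dim_vline n_neq0.
have dX : \dim X = 3%N.
  apply/eqP; rewrite eqn_leq; apply/andP; split.
    by apply: leq_trans (dim_add_line_le _ _) _; rewrite dL.
  by rewrite -ltnS; apply: leq_trans (dim_add_line_le _ n); rewrite addvC dX4.
have nX : n \notin X.
  by apply/negP=> nX; move: dX4; rewrite addvC (addv_idPl _) -?memvE // dX.
have yL : y \notin L.
  by apply/negP=> yL; move: dX; rewrite /X (addv_idPl _) -?memvE // dL.
have pL x : x \in L -> phi x = 0.
  by move=> /add_lineP [s [t ->]]; rewrite orth_lin // pa pb !mulr0 addr0.
have [d dL0 [d0 dy]] : exists2 d, d \in L & d != 0 /\ orth d y.
  suff : ~~ [forall d in L, (d != 0) ==> ~~ orth d y].
    rewrite negb_forall_in => /exists_inP [d dL0]; rewrite negb_imply negbK => /andP [d0 dy].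
    by exists d.
  (* Otherwise every zero of [X] lies in [L] or in [<[y]>]: at most q^2 + q vectors, fewer than 2q^2
     - q because q > 2. *)
  apply/negP => /forall_inP nrel.
  have big : (q ^ 2 < isotropics X)%N.
    rewrite -dL -card_vspace -cardsE.
    have -> : #|[set x in L]|.+1 = #|y |: [set x in L]|.
      by rewrite cardsU1 inE yL.
    apply/subset_leq_card/subsetP=> x; rewrite !inE => /predU1P [->|xL].
      by rewrite memv_add_line py /=.
    by rewrite (subvP (addvSl _ _)) // pL /=.
  have [|e] := isotropics_plane dX nX; first by rewrite leqNgt big.
  have : (isotropics X <= q ^ 2 + q)%N.
    have cy : #|[set x in <[y]>%VS]| = q.
      rewrite cardsE card_vspace dim_vline.
      by rewrite (contraNneq _ yL) // => ->; apply: mem0v.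
    have -> : (q ^ 2 + q = #|[set x in L]| + #|[set x in <[y]>%VS]|)%N.
      by rewrite cy cardsE card_vspace dL.
    apply: leq_trans (leq_card_setU _ _); apply/subset_leq_card/subsetP=> x.
    rewrite !inE => /andP [/memv_add_lineP [k xL] /eqP px].
    set d := x - k *: y in xL.
    have [k0|k0] := eqVneq k 0; first by move: xL; rewrite /d k0 scale0r subr0 => ->.
    have [d0|d0] := eqVneq d 0.
      by apply/orP; right; rewrite -[x](subrK (k *: y)) -/d d0 add0r memvZ ?memv_line.
    have := nrel _ xL; rewrite d0 /= -(orthZr _ _ k0) /orth subrK px pL // phiZ py mulr0.
    by rewrite addr0 eqxx.
  have : (3 * q <= q * q)%N by rewrite leq_mul2r q_gt2 orbT.
  by rewrite e; move: q_gt2; rewrite -mulnn; move: q => m; lia.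
have [s [t dE]] := add_lineP _ _ _ dL0.
have {}dy : orth d (b + c) by move: dy; rewrite /y -scaleNr orth_shift.
have [t0|t0] := eqVneq t 0.
  have s0 : s != 0 by apply: contraNneq d0 => s0; rewrite dE s0 t0 !scale0r addr0.
  by move: dy; rewrite dE t0 scale0r addr0 orthZl.
(* The vector d - t(b + c) equals sa - tc, a zero since [a] and [c] are orthogonal; linearity on [d]
   and [b + c] gives it the value -tf. *)
have f0 : f = 0.
  have := orth_lin 1 (- t) dy; rewrite (_ : 1 *: d + - t *: (b + c) = s *: a + (- t) *: c).
    rewrite orth_lin // pa pc (pL d) // !mulr0 !addr0 add0r => /eqP.
    by rewrite eq_sym mulf_eq0 oppr_eq0 (negPf t0) /= => /eqP.
  by rewrite dE; apply/rowP=> i; rewrite !mxE; ring.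
have bc : orth b c by rewrite /orth pb pc addr0 -/f f0.
(* The points kb + c and -ma - c on two sides of the triangle have a sum on the third side, so their
   join is full. The choice m = k/(k - 1) puts a + b + c on it; a suitable k exists because q >
   2. *)
have [k [k0 k1]] : exists k : F, k != 0 /\ k != 1.
  suff : ~~ [forall k : F, (k == 0) || (k == 1)].
    by rewrite negb_forall => /existsP [k]; rewrite negb_or => /andP []; exists k.
  apply/negP=> /forallP h; have : (q <= #|[set (0%R : F); 1%R]|)%N.
    by rewrite -cardsT; apply/subset_leq_card/subsetP=> x _; rewrite !inE.
  by rewrite cards2 eq_sym oner_eq0 leqNgt q_gt2.
have k10 : k - 1 != 0 by rewrite subr_eq0.
pose m := k / (k - 1).
have pu : phi (k *: b + 1 *: c) = 0 by rewrite orth_lin // pb pc !mulr0 addr0.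
have pv : phi ((- m) *: a + (- 1) *: c) = 0 by rewrite orth_lin // pa pc !mulr0 addr0.
have uv : orth (k *: b + 1 *: c) ((- m) *: a + (- 1) *: c).
  rewrite /orth pu pv addr0.
  have -> : k *: b + 1 *: c + (- m *: a + -1 *: c) = - m *: a + k *: b.
    by apply/rowP=> i; rewrite !mxE; ring.
  by rewrite orth_lin // pa pb !mulr0 addr0.
rewrite /orth -/f f0 pa addr0.
have := orth_lin k^-1 (- (1 - k^-1)) uv; rewrite pu pv !mulr0 addr0 => <-.
apply/eqP; congr phi; apply/rowP=> i; rewrite !mxE /m; field.
by rewrite k0 k10.
Qed.

(** For projected vectors, [orthD_isotropic] covers the independent case; if [n], [a], [b], [c] are
    dependent, [orth_addl] and shifts along [n] suffice. *)
Lemma orthD a b c : orth a b -> orth a c -> orth a (b + c).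
Proof.
move=> ab ac.
suff : orth (project a) (project b + project c).
  rewrite /project -!scaleNr orth_shiftl addrACA -scalerDl orth_shift //.
move: ab ac; rewrite -(orth_project a b) -(orth_project a c).
move: (phi_project a) (phi_project b) (phi_project c).
move: (project a) (project b) (project c) => {}a {}b {}c pa pb pc ab ac.
have [/vlineP [s ->]|an] := boolP (a \in <[n]>%VS); first by rewrite orthC orthn.
have [/memv_add_lineP [s /vlineP [t e]]|bn] := boolP (b \in <[n]> + <[a]>)%VS.
  rewrite -[b](subrK (s *: a)) e -addrA addrC orth_shift; exact: orth_addl.
have [/memv_add_lineP [s /memv_add_lineP [k /vlineP [t e]]]|cn] :=
    boolP (c \in <[n]> + <[a]> + <[b]>)%VS.
  have -> : b + c = k *: a + (1 + s) *: b + t *: n.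
    by rewrite -e; apply/rowP=> i; rewrite !mxE; ring.
  by rewrite orth_shift; apply: orth_addl; rewrite -[a]scale1r orthZ.
exact: orthD_isotropic.
Qed.

(** * Orthogonal subspaces and their dimension *)

Definition perp a : {vspace V} := <<enum [set b | orth a b]>>%VS.

Lemma perpE a b : (b \in perp a) = orth a b.
Proof.
rewrite vspace_closed ?inE //; first by rewrite /orth addr0 phi0 addr0.
move=> s x y; rewrite !inE => ax ay; apply: orthD => //.
by rewrite -[a]scale1r orthZ.
Qed.

(** Equal values at s != t make b + sa orthogonal to (t - s)a, hence [b] orthogonal to [a]. On a
    finite field injectivity then gives the zero of [phi_line_surj]. *)
Lemma phi_line_inj a b : phi a = 0 -> ~~ orth a b ->
  injective (fun t => phi (b + t *: a)).
Proof.
move=> pa nab s t e; apply/eqP; apply: contraNT nab => st.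
have : orth (b + s *: a) ((t - s) *: a).
  by rewrite /orth -addrA -scalerDl [s + _]addrC subrK e phiZ pa mulr0 addr0.
rewrite orthZr ?subr_eq0 1?eq_sym // orthC => /(orth_addl (- s)).
by rewrite addrC scaleNr addrK.
Qed.

Lemma phi_line_surj a b : phi a = 0 -> ~~ orth a b ->
  exists t, phi (b + t *: a) = 0.
Proof.
move=> pa nab; have [g _ gK] := injF_bij (phi_line_inj pa nab).
by exists (g 0); apply: gK.
Qed.

(** A zero [a] lies in some elliptic solid [X]. There no zero off [<[a]>] is orthogonal to [a], and
    each vector not orthogonal to [a] is uniquely one of these q^3 - q^2 zeros plus a multiple of
    [a]. This leaves q^3 vectors of [X] orthogonal to [a]; [n] is a further one outside [X]. *)
Lemma dim_perp a : a \notin <[n]>%VS -> \dim (perp a) = 4%N.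
Proof.
move=> an.
have -> : perp a = perp (project a).
  by apply/vspaceP=> x; rewrite !perpE /project -scaleNr orth_shiftl.
have : project a != 0.
  by apply: contraNneq an => /eqP; rewrite subr_eq0 => /eqP ->; rewrite memvZ ?memv_line.
move: (phi_project a); move: (project a) => {an}a pa a0.
have [w ew wa] := elliptic_exists a0 pa.
set X := ann <[w]>; have aX : a \in X by rewrite ann_line wa.
have w0 : w != 0 by apply: contraNneq (n_elliptic ew) => ->; rewrite dot0l.
have dX : \dim X = 4%N by rewrite dim_ann dim_vline w0.
have nX : n \notin X by rewrite ann_line n_elliptic.
pose Z := [set x in X | phi x == 0] :\: [set x in <[a]>%VS].
have zna z : z \in Z -> ~~ orth a z.
  rewrite !inE => /and3P [za zX /eqP pz]; apply/negP=> az.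
  have sX : (<[a]> + <[z]> <= X)%VS by apply: sub_add_lines.
  have := elliptic_line ew (dim_add_lines a0 za) sX.
  rewrite isotropic_line_full //; last by apply/eqP; move: az; rewrite /orth pa pz addr0.
  by rewrite -mulnn ltn_pmul2r ?q_gt0 // ltnNge ltnW.
have cZ : (#|Z| + q = q ^ 3 - q * q.-1)%N.
  rewrite -(isotropics_elliptic ew) -/X.
  rewrite -[RHS](cardsID [set x in <[a]>%VS]) addnC; congr (_ + _)%N.
  transitivity #|[set x in <[a]>%VS]|.
    by rewrite cardsE card_vspace dim_vline a0.
  apply: eq_card => x; rewrite !inE andbC; apply/esym/andb_idr => /vlineP [k ->].
  by rewrite memvZ //= phiZ pa mulr0.
have c1 : (#|Z| * q)%N = #|[set x in X] :\: [set x in perp a]|.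
  pose f (z : V * F) := z.1 + z.2 *: a.
  have inj : {in setX Z setT &, injective f}.
    move=> [x s] [y t] /setXP [xZ _] /setXP [yZ _]; rewrite /f /= => e.
    have [st|st] := eqVneq s t; first by move: e; rewrite st => /addIr ->.
    have yE : y = x + (s - t) *: a by rewrite scalerBl addrA e addrK.
    move: (zna _ xZ); rewrite -[orth a x](orthZl _ _ (_ : s - t != 0)) ?subr_eq0 //.
    move: xZ yZ; rewrite !inE => /and3P [_ _ /eqP px] /and3P [_ _ /eqP py].
    by rewrite orthC /orth -yE phiZ px py pa mulr0 addr0 eqxx.
  have -> : q = #|[set: F]| by rewrite cardsT.
  rewrite -cardsX -(card_in_imset inj).
  apply: eq_card => x; apply/imsetP/idP=> [[[z s] /setXP [zZ _] ->]|].
    have := zZ; have := zna _ zZ; rewrite !inE perpE /f /= => nz /and3P [_ zX _].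
    rewrite memvD ?memvZ // andbT; apply: contraNN nz => /(orth_addl (- s)).
    by rewrite addrC scaleNr addrK.
  rewrite !inE perpE => /andP [ax xX].
  have [t pt] := phi_line_surj pa ax.
  exists (x + t *: a, - t); last by rewrite /f /= scaleNr addrK.
  have zX : x + t *: a \in X by rewrite memvD ?memvZ.
  rewrite !inE /= pt zX eqxx !andbT.
  apply: contraNN ax => /vlineP [k xk].
  rewrite -[x](addrK (t *: a)) xk -scalerBl -[X in orth X _]scale1r orthZ //.
  by rewrite /orth pa -mulr2n -scaler_nat phiZ pa mulr0 addr0.
have c2 : #|(X :&: perp a)%VS| = (q ^ 3)%N.
  have cX : #|[set x in X]| = (q ^ 4)%N by rewrite cardsE card_vspace dX.
  have := cardsID [set x in perp a] [set x in X]; rewrite -c1 cX.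
  have -> : #|[set x in X] :&: [set x in perp a]| = #|(X :&: perp a)%VS|.
    by apply: eq_card => x; rewrite !inE memv_cap.
  move: cZ q_gt2; move: #|Z| #|_| q => z c Q; nia.
have dXp : \dim (X :&: perp a) = 3%N.
  by move/eqP: c2; rewrite card_vspace eqn_exp2l ?finRing_gt1 // => /eqP.
have := dimv_sum_cap X (perp a); rewrite dX dXp.
have -> : (X + perp a = fullv)%VS.
  apply/eqP; rewrite eqEdim subvf dim_rV /=.
  have : (X + <[n]> <= X + perp a)%VS.
    by apply: addvS => //; rewrite -memvE perpE -[n]scale1r orthn.
  by move/dimvS; rewrite dim_add_line // dX.
by rewrite dim_rV -[(5 + 3)%N]/(4 + 4)%N => /addnI <-.
Qed.

(** * Splitting off hyperbolic pairs, and frames *)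

Lemma orth_projectr a b : orth a (project b) = orth a b.
Proof. by rewrite /project -scaleNr orth_shift. Qed.

Lemma orthN_notin a b : ~~ orth a b -> a \notin <[n]>%VS.
Proof. by apply: contraNN => /vlineP [k ->]; rewrite orthC orthn. Qed.

(** By [dim_perp] each orthogonality condition costs at most one dimension, and only 0 in the span
    of [a] and [b] is orthogonal to both; the dimensions then leave no room. *)
Lemma perp_split Y a b : a \in Y -> b \in Y -> ~~ orth a b ->
  (<[a]> + <[b]> + (Y :&: (perp a :&: perp b)) = Y)%VS /\
  (\dim (Y :&: (perp a :&: perp b))).+2 = \dim Y.
Proof.
move=> aS bS nab; have an := orthN_notin nab.
have bn : b \notin <[n]>%VS by apply: (@orthN_notin b a); rewrite orthC.
have cap X c : c \notin <[n]>%VS -> (\dim X <= (\dim (X :&: perp c)).+1)%N.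
  move=> cn; have := dimv_sum_cap X (perp c); rewrite dim_perp //.
  have : (\dim (X + perp c) <= 5)%N.
    exact: leq_trans (dimvS (subvf (X + perp c)%VS)) (eq_leq (dim_rV F 5)).
  move: (\dim _) (\dim _) (\dim _) => m1 m2 m3; lia.
set U := (Y :&: _)%VS.
have dU : (\dim Y <= (\dim U).+2)%N.
  by rewrite /U capvA; apply: leq_trans (cap Y a an) _; rewrite ltnS cap.
have aP : orth a a by rewrite /orth -[a]scale1r -scalerDl !phiZ mul1r mulrDl mul1r.
have bP : orth b b by rewrite /orth -[b]scale1r -scalerDl !phiZ mul1r mulrDl mul1r.
have ba : b \notin <[a]>%VS.
  by apply: contraNN nab => /vlineP [k ->]; rewrite -[X in orth X _]scale1r orthZ.
have a0 : a != 0 by apply: contraNneq an => ->; apply: mem0v.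
have dLU : ((<[a]> + <[b]>) :&: U = 0)%VS.
  apply/eqP; rewrite -subv0; apply/subvP=> x.
  rewrite memv_cap memv0 => /andP [/add_lineP [s [t ->]]].
  rewrite !memv_cap !perpE => /and3P [_ ax bx].
  have t0 : t = 0.
    apply/eqP; apply: contraNT nab => t0.
    by rewrite -(orthZr _ _ t0) -[t *: b](addKr (s *: a)) addrC -scaleNr addrC orth_addl.
  have s0 : s = 0.
    apply/eqP; apply: contraNT nab => s0.
    by move: bx; rewrite t0 scale0r addr0 orthZr // orthC.
  by rewrite s0 t0 !scale0r addr0.
have sub : (<[a]> + <[b]> + U <= Y)%VS by rewrite subv_add sub_add_lines // capvSl.
have dsum : \dim (<[a]> + <[b]> + U) = (\dim U).+2.
  by rewrite dimv_disjoint_sum // dim_add_lines // add2n.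
have le := dimvS sub; rewrite dsum in le.
split; last by apply/eqP; rewrite eqn_leq le.
by apply/eqP; rewrite eqEdim sub dsum.
Qed.

(** Two successive splittings; what is left has dimension 1 and contains [n]. *)
Lemma frame_exists : exists e1 e2 e3 e4,
  [/\ [/\ phi e1 = 0, phi e2 = 0, phi e3 = 0 & phi e4 = 0],
      [/\ orth e1 e3, orth e1 e4, orth e2 e3 & orth e2 e4],
      ~~ orth e1 e2, ~~ orth e3 e4 &
      forall v, exists x0 x1 x2 x3 x4 : F,
        v = x1 *: e1 + x2 *: e2 + (x3 *: e3 + x4 *: e4) + x0 *: n].
Proof.
have d5 := dim_rV F 5.
have [a0 _ a0n] : exists2 x, x \in (fullv : {vspace V}) & x \notin <[n]>%VS.
  by apply: ex_notin; rewrite d5 dim_vline n_neq0.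
have [b0 _ a0b0] : exists2 x, x \in (fullv : {vspace V}) & x \notin perp a0.
  by apply: ex_notin; rewrite d5 dim_perp.
pose a := project a0; pose b := project b0.
have nab : ~~ orth a b by rewrite orth_project -perpE.
have [eV dV] := perp_split (memvf a) (memvf b) nab.
set U := (fullv :&: _)%VS in eV dV.
have dU : \dim U = 3%N by move: dV; rewrite d5 => [[]].
have UE x : (x \in U) = orth a x && orth b x by rewrite !memv_cap !perpE memvf.
have nU : n \in U by rewrite UE -[n]scale1r !orthn.
have [c0 c0U c0n] : exists2 x, x \in U & x \notin <[n]>%VS.
  by apply: ex_notin; rewrite dU dim_vline n_neq0.
have [d0 d0U c0d0] : exists2 x, x \in U & x \notin perp c0.
  (* If [U] were orthogonal to [c0], then, as [a] and [b] are, the whole space would be, against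
     [dim_perp]. *)
  apply/subvPn; apply/negP => sU.
  have : (fullv <= perp c0)%VS.
    rewrite -eV subv_add sU andbT; apply: sub_add_lines; rewrite perpE orthC.
      by move: c0U; rewrite UE => /andP [].
    by move: c0U; rewrite UE => /andP [].
  by move/dimvS; rewrite d5 dim_perp.
pose c := project c0; pose d := project d0.
have ncd : ~~ orth c d by rewrite orth_project -perpE.
have cU : c \in U by move: c0U; rewrite !UE !orth_projectr.
have dU0 : d \in U by move: d0U; rewrite !UE !orth_projectr.
have [eU dN] := perp_split cU dU0 ncd; set N := (U :&: _)%VS in eU dN.
have eN : (<[n]> = N)%VS.
  apply/eqP; rewrite eqEdim -memvE memv_cap nU memv_cap !perpE -{1 2}[n]scale1r !orthn /=.
  by rewrite dim_vline n_neq0 /= -ltnS -ltnS -/N dN dU.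
exists a, b, c, d; rewrite !phi_project; split=> //.
  by move: cU dU0; rewrite !UE => /andP [-> ->] /andP [-> ->].
move=> v; have : v \in (fullv : {vspace V}) by apply: memvf.
rewrite -eV => /memv_addP [x /add_lineP [x1 [x2 ->]] [y]].
rewrite -eU -eN => /memv_addP [z /add_lineP [x3 [x4 ->]] [t /vlineP [x0 ->] ->] ->].
by exists x0, x1, x2, x3, x4; rewrite !addrA.
Qed.

(** The vector [e1 + s *: e3] is not orthogonal to [e2], so its orthogonal is a hyperplane missing
    [e2], into which a multiple of [e2] moves [e4]. *)
Lemma transversal e1 e2 e3 e4 s : orth e2 e3 -> ~~ orth e1 e2 ->
  exists t, orth (e1 + s *: e3) (e4 - t *: e2).
Proof.
move=> r23 n12; set u := e1 + _.
have nu : ~~ orth u e2.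
  apply: contraNN n12; rewrite orthC [orth e1 _]orthC => r.
  rewrite -[e1](addrK (s *: e3)) -scaleNr orthD //.
  by rewrite -[e2]scale1r orthZ.
have : e4 \in (perp u + <[e2]>)%VS.
  suff -> : (perp u + <[e2]>)%VS = fullv by apply: memvf.
  apply/eqP; rewrite eqEdim subvf dim_rV /= dim_add_line ?perpE //.
  by rewrite dim_perp // (orthN_notin nu).
by move=> /memv_add_lineP [t]; rewrite perpE; exists t.
Qed.

(** * Characteristic 2: the square of [phi] in coordinates *)

Hypothesis char2 : 2%N \in [pchar F].

Let addFF (s : F) : s + s = 0.
Proof. exact: addrr_pchar2. Qed.

Lemma sqrD s t : (s + t) ^+ 2 = s ^+ 2 + t ^+ 2.
Proof. by rewrite sqrrD mulr2n addFF addr0. Qed.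

Lemma sqrt_exists t : exists s, s ^+ 2 = t.
Proof.
have inj : injective (fun s : F => s ^+ 2).
  move=> x y /= e; apply/eqP.
  by rewrite -subr_eq0 -sqrf_eq0 GRing.subr_pchar2 // sqrD e addFF.
by have [g _ gK] := injF_bij inj; exists (g t); apply: gK.
Qed.

Lemma phi_sqr_coord : exists (e1 e2 e3 e4 : V) (k m : F),
  (forall v, exists x0 x1 x2 x3 x4 : F,
     v = x1 *: e1 + x2 *: e2 + (x3 *: e3 + x4 *: e4) + x0 *: n) /\
  (forall x0 x1 x2 x3 x4 : F,
     phi (x1 *: e1 + x2 *: e2 + (x3 *: e3 + x4 *: e4) + x0 *: n) ^+ 2 =
     x0 ^+ 2 + k * (x1 * x2) + m * (x3 * x4)).
Proof.
have [e1 [e2 [e3 [e4 [[p1 p2 p3 p4] [r13 r14 r23 r24] n12 n34 span]]]]] := frame_exists.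
pose h s t := phi (s *: e1 + t *: e2).
have hZ s t z : h (z * s) (z * t) = z * h s t.
  by rewrite /h -phiZ scalerDr !scalerA.
have hinj : injective (h 1).
  move=> s t; rewrite /h scale1r; apply: (phi_line_inj p2).
  by rewrite orthC.
have rsum (x1 x2 x3 x4 : F) : orth (x1 *: e1 + x2 *: e2) (x3 *: e3 + x4 *: e4).
  by apply: orthD; rewrite orthC; apply: orthD; rewrite orthC; apply: orthZ; rewrite // orthC.
(* Both vectors are zeros on sides of the quadrangle, so their join is full. Expanding [phi] at one
   of its points with [rsum] compares the e1, e2 part with the e3, e4 part. *)
have hk s z t : orth (e1 + s *: e3) (e4 - t *: e2) -> h 1 (z * t) = phi (s *: e3 + z *: e4).
  move=> r; have := orth_lin 1 z r.
  have -> : phi (e1 + s *: e3) = 0.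
    by have := orth_lin 1 s r13; rewrite scale1r p1 p3 !mulr0 addr0.
  have -> : phi (e4 - t *: e2) = 0.
    have := orth_lin (- t) 1 r24; rewrite scale1r p2 p4 !mulr0 addr0 => <-.
    by rewrite scaleNr addrC.
  rewrite !mulr0 addr0.
  have -> : 1 *: (e1 + s *: e3) + z *: (e4 - t *: e2) =
            (1 *: e1 + (- (z * t)) *: e2) + (s *: e3 + z *: e4).
    by apply/rowP=> i; rewrite !mxE; ring.
  have /eqP -> := rsum 1 (- (z * t)) s z.
  by rewrite oppr_pchar2 // -/(h 1 (z * t)) => /eqP; rewrite addr_eq0 oppr_pchar2 // => /eqP.
(* The constant [l] comes from the single transversal through e1 + e4, while [t] belongs to the one
   through e1 + s e3. Both express phi(s e3 + e4), as h(1, sl) and h(1, t), so t = sl by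
   injectivity. *)
have [l hc] : exists l, forall s z, phi (s *: e3 + z *: e4) = h 1 (l * (s * z)).
  have [l rc] := transversal e3 1 r24 n12; exists l => s z.
  have [t rt] := transversal e4 s r23 n12.
  suff -> : l * (s * z) = z * t by rewrite (hk s z t).
  have tE : t = s * l.
    have rc1 : orth (e1 + 1 *: e4) (e3 - l *: e2) by [].
    apply: hinj; rewrite -[t]mul1r (hk s 1 t rt).
    have := orth_lin 1 s rc1.
    have -> : phi (e1 + 1 *: e4) = 0.
      by have := orth_lin 1 1 r14; rewrite scale1r p1 p4 !mulr0 addr0.
    have -> : phi (e3 - l *: e2) = 0.
      have := orth_lin (- l) 1 r23; rewrite scale1r p2 p3 !mulr0 addr0 => <-.
      by rewrite scaleNr addrC.
    rewrite !mulr0 addr0.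
    have -> : 1 *: (e1 + 1 *: e4) + s *: (e3 - l *: e2) =
            (1 *: e1 + (- (s * l)) *: e2) + (s *: e3 + 1 *: e4).
      by apply/rowP=> i; rewrite !mxE; ring.
    have /eqP -> := rsum 1 (- (s * l)) s 1.
    by rewrite oppr_pchar2 // -/(h 1 (s * l)) => /eqP; rewrite addr_eq0 oppr_pchar2 // => /eqP.
  by rewrite tE; ring.
have c0 : l != 0.
  apply: contraNneq n34 => c0; have := hc 1 1.
  rewrite c0 mul0r /h !scale1r scale0r addr0 p1 => p34.
  by rewrite /orth p34 p3 p4 addr0.
(* Writing s^2 as l * s * (s/l) turns the value into phi(s e3 + (s/l) e4), from which homogeneity
   extracts s. *)
have hsqr s : h 1 (s ^+ 2) = s * h 1 1.
  have := hc s (s * l^-1); rewrite (_ : l * (s * (s * l^-1)) = s ^+ 2); last by field.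
  move=> <-; have := hc 1 l^-1; rewrite mul1r mulfV // => <-.
  by rewrite -phiZ scalerDr !scalerA mulr1.
have h2 s t : h s t ^+ 2 = h 1 1 ^+ 2 * (s * t).
  have [->|s0] := eqVneq s 0.
    by rewrite /h scale0r add0r phiZ p2 mulr0 mul0r mulr0 expr0n.
  have [r rE] := sqrt_exists (t / s).
  have -> : h s t = s * h 1 (r ^+ 2) by rewrite -hZ mulr1 rE mulrC divfK.
  by rewrite hsqr !exprMn rE; field.
exists e1, e2, e3, e4, (h 1 1 ^+ 2), (h 1 1 ^+ 2 * l); split=> // x0 x1 x2 x3 x4.
rewrite phi_shift; have /eqP -> := rsum x1 x2 x3 x4.
by rewrite hc -/(h x1 x2) !sqrD (h2 x1 x2) (h2 1 (l * (x3 * x4))); ring.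
Qed.

(** * The quadratic form and its restriction to elliptic solids *)

Definition phi_form x := phi x ^+ 2.

Lemma form_quadratic : quadratic_form phi_form.
Proof.
split=> [s x | y]; first by rewrite /phi_form phiZ exprMn.
have [e1 [e2 [e3 [e4 [k [m [span QE]]]]]]] := phi_sqr_coord.
have [y0 [y1 [y2 [y3 [y4 ->]]]]] := span y.
pose v5 (a0 a1 a2 a3 a4 : F) := a1 *: e1 + a2 *: e2 + (a3 *: e3 + a4 *: e4) + a0 *: n.
have vD (a0 a1 a2 a3 a4 b0 b1 b2 b3 b4 : F) : v5 a0 a1 a2 a3 a4 + v5 b0 b1 b2 b3 b4 =
    v5 (a0 + b0) (a1 + b1) (a2 + b2) (a3 + b3) (a4 + b4).
  by rewrite /v5 addrACA -scalerDl; congr (_ + _); rewrite addrACA;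
     congr (_ + _); rewrite addrACA -!scalerDl.
have vZ (s a0 a1 a2 a3 a4 : F) : s *: v5 a0 a1 a2 a3 a4 = v5 (s * a0) (s * a1) (s * a2) (s * a3) (s * a4).
  by rewrite /v5 !scalerDr !scalerA.
have polarE (a0 a1 a2 a3 a4 : F) : polar phi_form (v5 a0 a1 a2 a3 a4) (v5 y0 y1 y2 y3 y4) =
    (y0 + y0) * a0 + k * (a1 * y2 + y1 * a2) + m * (a3 * y4 + y3 * a4).
  rewrite /polar vD /phi_form !QE; ring.
move=> s u v.
have [u0 [u1 [u2 [u3 [u4 ->]]]]] := span u.
have [v0 [v1 [v2 [v3 [v4 ->]]]]] := span v.
rewrite -!/(v5 _ _ _ _ _) vZ vD !polarE; ring.
Qed.

Lemma polar_sqr x y : polar phi_form x y = (phi (x + y) + (phi x + phi y)) ^+ 2.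
Proof. by rewrite /polar /phi_form !sqrD !GRing.subr_pchar2 // addrA. Qed.

Lemma polar_eq0 x y : (polar phi_form x y == 0) = orth x y.
Proof. by rewrite polar_sqr sqrf_eq0 addr_eq0 oppr_pchar2. Qed.

(** Off [<[n]>] a radical vector would contradict [dim_perp]; on [<[n]>] only 0 is a zero of
    [phi]. *)
Lemma form_nonsingular : nonsingular phi_form.
Proof.
move=> x /eqP; rewrite sqrf_eq0 => /eqP px h.
have [/vlineP [k xk]|xn] := boolP (x \in <[n]>%VS).
  by move: px; rewrite xk phiZ phi_n mulr1 => ->; rewrite scale0r.
have : (fullv <= perp x)%VS by apply/subvP=> y _; rewrite perpE -polar_eq0 h.
by move/dimvS; rewrite dim_rV dim_perp.
Qed.

Lemma form_isotropic x : (phi_form x == 0) = (phi x == 0).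
Proof. exact: sqrf_eq0. Qed.

Lemma form0 x : phi x = 0 -> phi_form x = 0.
Proof. by move=> /eqP; rewrite -form_isotropic => /eqP. Qed.

Lemma form_addr x y : orth x y -> phi_form (x + y) = phi_form x + phi_form y.
Proof. by move=> /eqP e; rewrite /phi_form e sqrD. Qed.

Lemma form_lin s t x y : phi_form (s *: x + t *: y) =
  s ^+ 2 * phi_form x + s * t * polar phi_form x y + t ^+ 2 * phi_form y.
Proof.
have [QZ Qsc] := form_quadratic.
have polC u v : polar phi_form u v = polar phi_form v u.
  by rewrite /polar [u + v]addrC -!addrA [- phi_form u + _]addrC.
have polZ k u v : polar phi_form (k *: u) v = k * polar phi_form u v.
  have := Qsc v k u 0; rewrite addr0 /= => ->.
  by rewrite {2}/polar add0r /phi_form phi0 expr0n subr0 subrr addr0.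
have e u v : phi_form (u + v) = phi_form u + polar phi_form u v + phi_form v.
  by rewrite /polar -addrA subrK addrC subrK.
by rewrite e !QZ polZ polC polZ polC mulrA.
Qed.

(** Otherwise [x] and [y] would span a full line inside an elliptic solid. *)
Lemma elliptic_anisotropic w x y : elliptic w -> dot w x = 0 -> dot w y = 0 ->
  x != 0 -> phi x = 0 -> phi y = 0 -> orth x y -> y \in <[x]>%VS.
Proof.
move=> ew wx wy x0 px py xy; apply/negPn/negP => yx.
have sX : (<[x]> + <[y]> <= ann <[w]>)%VS.
  by apply: sub_add_lines; rewrite ann_line ?wx ?wy.
have := elliptic_line ew (dim_add_lines x0 yx) sX.
rewrite isotropic_line_full //; last by apply/eqP; move: xy; rewrite /orth px py addr0.
by rewrite -mulnn ltn_pmul2r ?q_gt0 // ltnNge ltnW.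
Qed.

(** A pair of zeros [u], [v] with polar value 1 is split off the solid. A nonzero zero in the
    remaining [W] would be orthogonal to [u], hence a multiple of [u], hence not orthogonal to [v]:
    so the form on [W] is anisotropic. *)
Lemma elliptic_form w : elliptic w -> elliptic_form_on (ann <[w]>) phi_form.
Proof.
move=> ew; set Y := ann _.
have w0 : w != 0 by apply: contraNneq (n_elliptic ew) => ->; rewrite dot0l.
have dY : \dim Y = 4%N by rewrite dim_ann dim_vline w0.
have nY : n \notin Y by rewrite ann_line n_elliptic.
have YE x : (x \in Y) = (dot w x == 0) by rewrite ann_line.
have [u] : exists u, u \in [set x in Y | phi x == 0] :\ 0.
  apply/set0Pn; rewrite -card_gt0.
  have q1 : (q ^ 3 - q * q.-1 = q ^ 2 * q.-1 + q)%N.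
    have -> : q = q.-1.+1 by rewrite prednK ?q_gt0.
    move: q.-1 => m; apply/(canLR (addnK _)); rewrite [m.+1.-1]/=; ring.
  have e := cardsD1 (0 : V) [set x in Y | phi x == 0].
  have : (q <= isotropics Y)%N by rewrite isotropics_elliptic // q1 leq_addl.
  rewrite /isotropics e; move: q_gt2; case: (_ \in _); move: #|_ :\ _| q => m k; lia.
rewrite !inE => /and3P [u0 uY /eqP pu].
have un : u \notin <[n]>%VS.
  apply: contraNN u0 => /vlineP [k uk]; move: pu; rewrite uk phiZ phi_n mulr1 => ->.
  by rewrite scale0r.
(* Otherwise [Y] and [n] together would make [u] orthogonal to everything. *)
have [v0 v0Y uv0] : exists2 v, v \in Y & v \notin perp u.
  apply/subvPn; apply/negP => sY.
  have : (Y + <[n]> <= perp u)%VS.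
    by rewrite subv_add sY -memvE perpE -[n]scale1r orthn.
  by move/dimvS; rewrite dim_add_line // dim_perp // dY.
rewrite perpE in uv0.
have [t pt] := phi_line_surj pu uv0.
set v1 := v0 + t *: u in pt.
have uv1 : ~~ orth u v1.
  apply: contraNN uv0 => /(orth_addl (- t)).
  by rewrite /v1 addrC scaleNr addrK.
have v1Y : v1 \in Y by rewrite memvD ?memvZ.
pose v := (polar phi_form u v1)^-1 *: v1.
have b0 : polar phi_form u v1 != 0 by rewrite polar_eq0.
have uv : ~~ orth u v by rewrite orthZr // invr_eq0.
have pv : phi v = 0 by rewrite phiZ pt mulr0.
have vY : v \in Y by rewrite memvZ.
have Qu := form0 pu; have Qv := form0 pv.
have Quv : polar phi_form u v = 1.
  have := form_lin 1 (polar phi_form u v1)^-1 u v1.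
  rewrite scale1r -/v Qu (form0 pt) !mulr0 add0r addr0 mul1r mulVf // => e.
  by rewrite /polar e Qu Qv !subr0.
have [eY dW] := perp_split uY vY uv; set W := (Y :&: _)%VS in eY dW.
have {}dW : \dim W = 2%N by move: dW; rewrite dY => [[]].
have WE x : x \in W -> [/\ dot w x = 0, orth u x & orth v x].
  by rewrite !memv_cap !perpE YE => /and3P [/eqP].
have aniso x : x \in W -> x != 0 -> phi_form x != 0.
  move=> /WE [wx ux vx] x0; rewrite form_isotropic; apply/eqP=> px.
  have wu : dot w u = 0 by apply/eqP; rewrite -YE.
  have /vlineP [k xk] := elliptic_anisotropic ew wu wx u0 pu px ux.
  case/negP: uv; rewrite orthC; move: vx x0; rewrite xk.
  by have [->|k0] := eqVneq k 0; [rewrite scale0r eqxx | rewrite orthZr].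
have [x xW x0] : exists2 x, x \in W & x \notin (0 : {vspace V})%VS.
  by apply: ex_notin; rewrite dW dimv0.
rewrite memv0 in x0.
have [y yW yx] : exists2 y, y \in W & y \notin <[x]>%VS.
  by apply: ex_notin; rewrite dW dim_vline x0.
have eW : (<[x]> + <[y]> = W)%VS.
  by apply/eqP; rewrite eqEdim sub_add_lines // dim_add_lines // dW.
have lW (s t' : F) : s *: x + t' *: y \in W by rewrite memvD ?memvZ.
exists [tuple x; y; u; v], (phi_form x), (polar phi_form x y), (phi_form y); split.
- rewrite basisEdim /= dY leqnn andbT -eY -eW !span_cons span_nil addv0.
  by rewrite [X in (X <= _)%VS]addvC !addvA subvv.
- exact: aniso.
- have sz : size (phi_form x *: 'X^2 + polar phi_form x y *: 'X + (phi_form y)%:P) = 3%N.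
    rewrite -addrA size_polyDl size_scale ?size_polyXn ?aniso //.
    apply: leq_ltn_trans (size_polyD _ _) _.
    rewrite gtn_max (leq_ltn_trans (size_scale_leq _ _)) ?size_polyX //=.
    by rewrite (leq_ltn_trans (size_polyC_leq1 _)).
  (* In degree 2 it suffices that there is no root; a root [s] would make s x + y a zero in [W]. *)
  apply: cubic_irreducible; rewrite ?sz // => s; rewrite /root.
  have := form_lin s 1 x y; rewrite expr1n mul1r mulr1 => e.
  have -> : (phi_form x *: 'X^2 + polar phi_form x y *: 'X + (phi_form y)%:P).[s] = phi_form (s *: x + 1 *: y).
    by rewrite e !hornerD !hornerZ hornerXn hornerX hornerC; ring.
  apply: aniso => //; apply: contraNneq yx => e0.
  apply/vlineP; exists (- s); apply/eqP; rewrite scaleNr -addr_eq0 addrC.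
  by rewrite -[y]scale1r e0.
- move=> k0 k1 k2 k3 /=.
  rewrite -addrA form_addr; last first.
    have [_ ux vx] := WE _ (lW k0 k1).
    by apply: orthD; rewrite -[_ + _]scale1r; apply: orthZ; rewrite orthC.
  rewrite !form_lin Quv Qu Qv; ring.
Qed.

End Geometry.

(** * Counting in the dual space *)

Section DualSet.

Variables (F : finFieldType) (p : nat) (D : {set 'rV[F]_5}).
Notation V := 'rV[F]_5.
Notation q := #|F|.
Implicit Types (x y u v w : V) (X Y : {vspace V}).

Notation deg := (deg D).
Notation numin := (numin D).

Hypothesis qE : q = (2 * p)%N.
Hypothesis p_gt1 : (1 < p)%N.
Hypothesis D0 : 0 \notin D.
Hypothesis DZ : forall a w, a != 0 -> w \in D -> a *: w \in D.
(** Here [2 * p ^ 2] is q^2/2, and the factor [q.-1] comes from counting vectors instead of points: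
    these are the numbers of (I), and those of [numin_line] are the numbers of (II). *)
Hypothesis deg_cases : forall x, x != 0 ->
  [\/ deg x = 0, deg x = q.-1 * (2 * p ^ 2) * q |
      deg x = q.-1 * (2 * p ^ 2) * q.-1]%N.
Hypothesis numin_line : forall Y, \dim Y = 2%N ->
  [\/ numin Y = 0, numin Y = q.-1 * p | numin Y = q.-1 * q]%N.

Lemma D_neq0 w : w \in D -> w != 0.
Proof. by apply: contraTneq => ->. Qed.

Lemma numin_point w : w \in D -> numin <[w]>%VS = q.-1.
Proof.
move=> wD; have w0 := D_neq0 wD.
rewrite -[RHS]/(#|F|.-1)%N -(cardC1 (0 : F)) /numin.
have inj : injective (fun a : F => a *: w).
  move=> a b /eqP; rewrite -subr_eq0 -scalerBl scaler_eq0 (negPf w0) orbF.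
  by rewrite subr_eq0 => /eqP.
rewrite -(card_imset _ inj); apply: eq_card => x; rewrite !inE.
apply/andP/imsetP=> [[xD /vlineP [a xa]] | [a a0 ->]].
  exists a => //; rewrite inE; apply: contraTneq xD => a0.
  by rewrite xa a0 scale0r.
by rewrite DZ // memvZ // memv_line.
Qed.

(* The directions in Y of the dual lines through <w> with q points in D. *)
Definition full_dirs w Y :=
  [set u in Y | (u \notin <[w]>%VS) && (numin (<[w]> + <[u]>)%VS == q.-1 * q)%N].

Lemma cardDl Y w : w != 0 -> w \in Y ->
  (#|[set u in Y | u \notin <[w]>%VS]| + q = #|Y|)%N.
Proof.
move=> w0 wY; have -> : q = #|<[w]>%VS| by rewrite card_vspace dim_vline w0 expn1.
rewrite -[RHS](cardID (mem <[w]>%VS)) addnC; congr (_ + _)%N; apply: eq_card => x.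
  rewrite !inE; case: vlineP => [[k ->]|]; last by rewrite andbF.
  by rewrite memvZ.
by rewrite !inE andbC.
Qed.

(** Double count of pairs of [u] in [Y] off [<[w]>] and [v] in [D] in the span of [w] and [u]. By
    [u], each span has p or q points of [D], as [w] excludes 0. By [v], those in [<[w]>] meet every
    [u], the others only the q^2 - q vectors of [<[w]> + <[v]>] off [<[w]>]. The terms are arranged
    to avoid subtraction. *)
Lemma full_dirsE w Y : w \in D -> w \in Y ->
  (p * #|Y| + p * #|full_dirs w Y| + q * q.-1 + q = #|Y| + q * numin Y + p * q)%N.
Proof.
move=> wD wY; have w0 := D_neq0 wD.
set B := [set u in Y | u \notin <[w]>%VS].
have cB : (#|B| + q = #|Y|)%N := cardDl w0 wY.
pose T := (\sum_(u in B) numin (<[w]> + <[u]>)%VS)%N.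
have T1 : T = (q.-1 * (p * #|B| + p * #|full_dirs w Y|))%N.
  rewrite /T (eq_bigr (fun u => q.-1 * p + q.-1 * p *
     (numin (<[w]> + <[u]>)%VS == q.-1 * q)))%N; last first.
    move=> u; rewrite inE => /andP [uY uw].
    have d2 := dim_add_lines w0 uw.
    have wn : (0 < numin (<[w]> + <[u]>)%VS)%N.
      rewrite /numin card_gt0; apply/set0Pn; exists w.
      by rewrite !inE wD (subvP (addvSl _ _)) // memv_line.
    have q1 : (0 < q.-1)%N by lia.
    case: (numin_line d2) => e; rewrite e ?eqxx in wn *; first by [].
      rewrite eqn_pmul2l // (_ : p == q = false) ?muln0 ?addn0 //.
      by apply/eqP; lia.
    by rewrite muln1 -mulnDr addnn -mul2n -qE.
  rewrite big_split /= sum_nat_const -big_distrr /= -big_mkcondr /=.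
  have -> : (\sum_(i in B | numin (<[w]> + <[i]>)%VS == (q.-1 * q)%N) 1
             = #|full_dirs w Y|)%N.
    by rewrite -sum1_card; apply: eq_bigl => u; rewrite !inE andbA.
  by rewrite (mulnC #|B|); move: #|B| #|full_dirs w Y| => m k; lia.
have T2 : (T = q.-1 * #|B| + (numin Y - q.-1) * (q ^ 2 - q))%N.
  have -> : (T = \sum_(v in [set v in D | v \in Y])
              #|[set u in B | v \in <[w]> + <[u]>]%VS|)%N.
    rewrite /T; under eq_bigr => u _ do rewrite /numin -sum1_card.
    under eq_bigr => u _.
      rewrite (eq_bigl (fun v => (v \in D) && (v \in <[w]> + <[u]>)%VS)); last first.
        by move=> v; rewrite inE.
    over.
    rewrite (exchange_big_dep [in [set v in D | v \in Y]]) /=; last first.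
      move=> u v; rewrite !inE => /andP [uY _] /andP [-> vu] /=.
      exact: subvP (sub_add_lines wY uY) _ vu.
    apply: eq_bigr => v; rewrite inE => /andP [vD _].
    by rewrite -sum1_card; apply: eq_bigl => u; rewrite !inE vD.
  rewrite (bigID (fun v => v \in <[w]>%VS)) /=; congr (_ + _)%N.
    rewrite (eq_bigr (fun _ => #|B|)); last first.
      move=> v /andP [_ vw]; apply: eq_card => u; rewrite !inE.
      by rewrite (subvP (addvSl _ _)) // andbT.
    rewrite sum_nat_const -(numin_point wD); congr (_ * _)%N.
    rewrite /numin -sum1_card -[RHS]sum1_card; apply: eq_bigl => v; rewrite unfold_in !inE.
    case: vlineP => [[k ->]|]; last by rewrite !andbF.
    by rewrite memvZ // !andbT.
  rewrite (eq_bigr (fun _ => (q ^ 2 - q)%N)); last first.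
    move=> v /andP []; rewrite inE => /andP [vD vY] vw.
    have -> : (q ^ 2 = #|(<[w]> + <[v]>)%VS|)%N by rewrite card_vspace dim_add_lines.
    rewrite -(@cardDl (<[w]> + <[v]>)%VS w) //; last first.
      by rewrite (subvP (addvSl _ _)) // memv_line.
    rewrite addnK; apply: eq_card => u; rewrite !inE.
    apply/idP/idP.
      by move=> /andP [/andP [uY uw] vu]; rewrite uw andbT memv_exchange.
    move=> /andP [uv uw]; rewrite uw andbT (subvP (sub_add_lines wY vY)) //=.
    exact: memv_exchange.
  rewrite sum_nat_const; congr (_ * _)%N.
  rewrite -(numin_point wD) /numin.
  set S1 := [set _ in _ | _]; set S2 := [set _ in _ | _].
  rewrite -(cardsID S2 S1) (setIidPr _) ?addKn; last first.
    apply/subsetP=> v; rewrite !inE => /andP [-> /vlineP [k ->]].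
    by rewrite memvZ.
  rewrite -sum1_card -[RHS]sum1_card; apply: eq_bigl => v; rewrite [LHS]unfold_in !inE.
  by case: (v \in D); rewrite ?andbF //= andbC.
have le : (q.-1 <= numin Y)%N.
  rewrite -(numin_point wD) /numin; apply/subset_leq_card/subsetP=> v; rewrite !inE.
  by move=> /andP [-> /vlineP [k ->]]; rewrite memvZ.
have q1 : (0 < q.-1)%N by lia.
have : (q.-1 * (p * #|B| + p * #|full_dirs w Y|) = q.-1 * (#|B| + (numin Y - q.-1) * q))%N.
  rewrite -T1 T2 mulnDr; congr (_ + _)%N.
  rewrite (_ : q ^ 2 - q = q.-1 * q)%N; first by rewrite mulnCA.
  by case: (q) q1 => // k _; rewrite /= expnS expn1 mulSn addKn.
move/eqP; rewrite eqn_pmul2l // => /eqP; rewrite -cB -(subnK le) addnK.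
move: (numin Y - q.-1)%N => m; move: q.-1 q #|B| #|full_dirs w Y| => r s b g h.
by rewrite !mulnDr; lia.
Qed.

Lemma full_dirsS w Y Y' : (Y <= Y')%VS -> (#|full_dirs w Y| <= #|full_dirs w Y'|)%N.
Proof.
move=> /subvP YY; apply/subset_leq_card/subsetP=> u; rewrite !inE => /andP [uY ->].
by rewrite YY.
Qed.

(** Explicit successors let [q.-1] compute, so that arithmetic tactics apply. *)
Lemma pE : exists k, p = k.+2 /\ q = (2 * k).+4.
Proof. by exists (p - 2)%N; split; lia. Qed.

(** [full_dirsE] with the number of full directions bounded below by 0. *)
Lemma numin_plane_ge Y w : \dim Y = 3%N -> w \in D -> w \in Y ->
  (q.-1 * (p * q.-1) <= numin Y)%N.
Proof.
move=> dY wD wY; have := full_dirsE wD wY; rewrite card_vspace dY.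
have [k [-> ->]] := pE; rewrite -[_.+4.-1]/(2 * k).+3; move: #|_| (numin Y) => g m h.
have : (k.+2 * (2 * k).+4 ^ 3 + ((2 * k).+4 * (2 * k).+3 + (2 * k).+4) <=
        (2 * k).+4 ^ 3 + (2 * k).+4 * m + k.+2 * (2 * k).+4)%N by lia.
rewrite (_ : k.+2 * _ + _ = (2 * k).+4 * ((2 * k).+3 * (k.+2 * (2 * k).+3)) +
  (2 * k).+4 ^ 3 + k.+2 * (2 * k).+4)%N; last by ring.
rewrite -addnA [leqRHS]addnAC -addnA [leqLHS]addnC [leqRHS]addnC; move=> h2.
have := leq_pmul2l (isT : 0 < (2 * k).+4)%N => <-; lia.
Qed.

Lemma numin_ann_line x : numin (ann <[x]>) = deg x.
Proof. by apply: eq_card => w; rewrite !inE ann_line dotC. Qed.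

Lemma degZ a x : a != 0 -> deg (a *: x) = deg x.
Proof.
move=> a0; apply: eq_card => w; rewrite !inE dotZr mulf_eq0.
by rewrite (negPf a0).
Qed.

Lemma deg0 : deg 0 = #|D|.
Proof. by apply: eq_card => w; rewrite !inE dot0r eqxx andbT. Qed.

Lemma sum_deg0 X :
  (q * \sum_(x in X | x != 0%R) deg x + q * #|D| =
   #|X| * (#|D| + q.-1 * numin (ann X)))%N.
Proof.
by rewrite -sum_deg [in RHS](bigD1 (0 : V)) ?mem0v //= deg0 mulnDr addnC.
Qed.

(** Solving [full_dirsE]; since one line accounts for q^2 - q directions, exactly one full line
    passes through [w] in this dual solid. *)
Lemma full_dirs_solid x w : x != 0 -> w \in D -> dot w x = 0 ->
    deg x = (q.-1 * (2 * p ^ 2) * q.-1)%N ->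
  #|full_dirs w (ann <[x]>)| = (q ^ 2 - q)%N.
Proof.
move=> x0 wD wx dx; have wY : w \in ann <[x]> by rewrite ann_line dotC wx.
have := full_dirsE wD wY; rewrite numin_ann_line dx card_vspace.
rewrite dim_ann dim_vline x0.
have [k [-> ->]] := pE; rewrite -[_.+4.-1]/(2 * k).+3 -[(5 - true)%N]/4%N.
rewrite (_ : _ ^ 2 - _ = (2 * k).+4 * (2 * k).+3)%N; last first.
  by rewrite expnS expn1 mulnS addKn.
move: #|_| => g h.
have : (k.+2 * g = k.+2 * ((2 * k).+4 * (2 * k).+3))%N by lia.
by move/eqP; rewrite eqn_pmul2l // => /eqP.
Qed.

(** * The size of [D] and the nucleus *)

Section Plane.

Variable Pi : {vspace V}.
Hypothesis dim_Pi : \dim Pi = 3%N.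
Hypothesis numin_Pi : numin Pi = (q.-1 * (p * (q + 1)))%N.

(** In [Pi], [full_dirsE] gives 2(q^2 - q) full directions at [w], that is two full lines, but a
    dual solid of the smaller nonzero degree has only one. So every nonzero [x] in [ann Pi] has the
    larger degree, and [sum_deg0] becomes an equation for [#|D|]. *)
Lemma card_D : #|D| = (q.-1 * (2 * p ^ 2) * (q.-1 * (q + 1)))%N.
Proof.
have [k [pk qk]] := pE.
have [w] : exists w, w \in [set w in D | w \in Pi].
  by apply/set0Pn; rewrite -card_gt0 -/(numin Pi) numin_Pi qk pk.
rewrite inE => /andP [wD wPi].
have degx x : x \in ann Pi -> x != 0 -> deg x = (q.-1 * (2 * p ^ 2) * q)%N.
  move=> /annP xPi x0; have wx : dot w x = 0 by rewrite dotC xPi.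
  case: (deg_cases x0) => //.
    move/eqP; rewrite cards_eq0 => /eqP h.
    by have := in_set0 w; rewrite -h !inE wD wx eqxx.
  move=> dx; have := full_dirs_solid x0 wD wx dx.
  have : (Pi <= ann <[x]>)%VS.
    by apply/subvP=> u uPi; rewrite ann_line xPi.
  move/(full_dirsS w) => le e; move: le; rewrite {}e.
  have := full_dirsE wD wPi; rewrite numin_Pi card_vspace dim_Pi.
  rewrite pk qk -[_.+4.-1]/(2 * k).+3.
  rewrite (_ : _ ^ 2 - _ = (2 * k).+4 * (2 * k).+3)%N; last first.
    by rewrite expnS expn1 mulnS addKn.
  move: #|_| => g h.
  have : (k.+2 * g = k.+2 * (2 * ((2 * k).+4 * (2 * k).+3)))%N by lia.
  by move/eqP; rewrite eqn_pmul2l // => /eqP ->; lia.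
have := sum_deg0 (ann Pi); rewrite annK numin_Pi.
rewrite (eq_bigr (fun _ => q.-1 * (2 * p ^ 2) * q))%N; last first.
  by move=> x /andP [xPi x0]; apply: degx.
have cX : #|ann Pi| = (q ^ 2)%N by rewrite card_vspace dim_ann dim_Pi.
rewrite sum_nat_const cX.
have -> : #|[pred x in ann Pi | x != 0]| = (q ^ 2).-1.
  by rewrite -cX [in RHS](cardD1 (0 : V)) mem0v /=; apply: eq_card => x; rewrite !inE andbC.
rewrite pk qk -[_.+4.-1]/(2 * k).+3 (_ : (_ ^ 2).-1 = (2 * k).+3 * (2 * k).+4.+1)%N; last by nia.
move=> h; apply/eqP; rewrite -(eqn_pmul2l (isT : 0 < (2 * k).+4 * (2 * k).+3)%N).
apply/eqP; move: h; move: #|D| => d; lia.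
Qed.

(** One factor [deg x] is expanded over [w] in [D]; after exchanging the sums, [sum_deg] on [ann
    <[w]>] evaluates the inner one. *)
Lemma sum_sqr_deg : (\sum_x deg x * deg x = #|D| * (q ^ 3 * (#|D| + q.-1 * q.-1)))%N.
Proof.
have -> : (\sum_x deg x * deg x = \sum_(w in D) \sum_(x in ann <[w]>%VS) deg x)%N.
  rewrite (exchange_big_dep xpredT) //=; apply: eq_bigr => x _.
  rewrite sum_nat_const; congr (_ * _)%N; rewrite /deg -sum1_card -[RHS]sum1_card.
  by apply: eq_bigl => w; rewrite [RHS]unfold_in !inE ann_line.
rewrite -sum_nat_const; apply: eq_bigr => w wD.
have := sum_deg D (ann <[w]>); rewrite annK numin_point // card_vspace dim_ann.
rewrite dim_vline D_neq0 // -[(5 - true)%N]/4%N expnS -mulnA => /eqP.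
by rewrite eqn_pmul2l ?q_gt0 // => /eqP.
Qed.

(** The moments of order 0, 1 and 2 of [deg] are three linear equations for the sizes of the three
    degree classes; the zero vector contributes 1, [#|D|] and its square. *)
Lemma card_deg0 : #|[set x : V | (x != 0) && (deg x == 0%N)]| = q.-1.
Proof.
have [k [pk qk]] := pE.
set T0 := [set x | _].
pose T1 := [set x : V | (x != 0) && (deg x == (q.-1 * (2 * p ^ 2) * q)%N)].
pose T2 := [set x : V | (x != 0) && (deg x == (q.-1 * (2 * p ^ 2) * q.-1)%N)].
have split (f : V -> nat) : (\sum_x f x = f 0%R + \sum_(x in T0) f x +
    \sum_(x in T1) f x + \sum_(x in T2) f x)%N.
  rewrite (bigD1 (0 : V)) //= -!addnA; congr (_ + _)%N.
  rewrite big_mkcond [X in _ = (X + _)%N]big_mkcond [X in _ = (_ + (X + _))%N]big_mkcond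
    [X in _ = (_ + (_ + X))%N]big_mkcond -!big_split /=; apply: eq_bigr => x _.
  rewrite !inE; case: eqVneq => //= x0.
  by case: (deg_cases x0) => ->; rewrite qk pk -[_.+4.-1]/(2 * k).+3; do 3 case: eqP => ?; lia.
have E0 : (q ^ 5 = 1 + #|T0| + #|T1| + #|T2|)%N.
  have := split (fun _ => 1%N); rewrite !sum1_card => <-.
  rewrite -[5%N in LHS](dim_rV F) -card_vspace.
  by apply: eq_card => x; rewrite memvf.
have E1 : (q ^ 4 * #|D| = #|D| + (q.-1 * (2 * p ^ 2) * q) * #|T1| +
   (q.-1 * (2 * p ^ 2) * q.-1) * #|T2|)%N.
  have <- : (\sum_x deg x = q ^ 4 * #|D|)%N.
    have := sum_deg D (fullv : {vspace V}).
    have -> : numin (ann fullv) = 0%N.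
      apply/eqP; rewrite cards_eq0; apply/eqP/setP=> w; rewrite !inE.
      apply/negP=> /andP [wD]; have -> : ann (fullv : {vspace V}) = 0%VS.
        by apply/eqP; rewrite -dimv_eq0 dim_ann dim_rV.
      by rewrite memv0 (negPf (D_neq0 wD)).
    rewrite card_vspace dim_rV muln0 addn0 expnS -mulnA => /eqP.
    rewrite eqn_pmul2l ?q_gt0 // => /eqP <-.
    by apply: eq_bigl => x; rewrite memvf.
  rewrite split deg0 big1 ?addn0; last by move=> x; rewrite inE => /andP [_ /eqP].
  congr (_ + _ + _)%N; rewrite mulnC -sum_nat_const; apply: eq_bigr => x;
    by rewrite inE => /andP [_ /eqP].
have E2 : (#|D| * (q ^ 3 * (#|D| + q.-1 * q.-1)) = #|D| * #|D| +
   (q.-1 * (2 * p ^ 2) * q) * (q.-1 * (2 * p ^ 2) * q) * #|T1| +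
   (q.-1 * (2 * p ^ 2) * q.-1) * (q.-1 * (2 * p ^ 2) * q.-1) * #|T2|)%N.
  rewrite -sum_sqr_deg split deg0 big1 ?addn0; last first.
    by move=> x; rewrite inE => /andP [_ /eqP ->].
  congr (_ + _ + _)%N; rewrite mulnC -sum_nat_const; apply: eq_bigr => x;
    by rewrite inE => /andP [_ /eqP ->].
have u2 : (q ^ 2 = 2 * (2 * p ^ 2))%N by rewrite qE expnMn; ring.
have qr : q = q.-1.+1 by rewrite qk.
have u_gt0 : (0 < q.-1 * (2 * p ^ 2))%N by rewrite qk pk.
move: E0 E1 E2 u_gt0; rewrite card_D; move: #|T0| #|T1| #|T2| => t0 t1 t2.
move: (2 * p ^ 2)%N u2; rewrite qr [_.+1.-1]/=.
have : (0 < q.-1)%N by rewrite qk.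
move: q.-1 => r r_gt0 u u2 E0 E1 E2 u_gt0.
have {}E1 : (r.+1 ^ 4 * (r * (r.+1 + 1)) = r * (r.+1 + 1) + r.+1 * t1 + r * t2)%N.
  apply/eqP; rewrite -(eqn_pmul2l u_gt0); apply/eqP.
  by transitivity (r.+1 ^ 4 * (r * u * (r * (r.+1 + 1))))%N; [ring | rewrite E1; ring].
have {}E2 : (r ^ 2 * (r.+1 + 1) ^ 2 * r.+1 ^ 3 + 2 * r.+1 * (r.+1 + 1) * r ^ 2 =
    r ^ 2 * (r.+1 + 1) ^ 2 + r.+1 ^ 2 * t1 + r ^ 2 * t2)%N.
  apply/eqP; rewrite -(eqn_pmul2l u_gt0) -(eqn_pmul2l u_gt0); apply/eqP.
  transitivity (r * u * (r * (r.+1 + 1)) *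
      (r.+1 ^ 3 * (r * u * (r * (r.+1 + 1)) + r * r)))%N; last by rewrite E2; ring.
  have e : (r.+1 ^ 3 * (r * r) = r * u * (2 * r.+1 * r))%N by rewrite expnS u2; ring.
  by rewrite [(r.+1 ^ 3 * _)%N]mulnDr e; ring.
(* Taking q times the first moment minus the second eliminates [t1], with common terms added instead
   of subtracted. The result is (q^2 + 1)(q + 1) points, as on Q(4,q). *)
have e2 : (t2 = (r.+1 ^ 2 + 1) * (r.+1 + 1) * r)%N.
  apply/eqP; rewrite -(eqn_pmul2l r_gt0).
  rewrite -(eqn_add2r (r ^ 2 * (r.+1 + 1) ^ 2 + r.+1 ^ 2 * t1 + r ^ 2 * t2 +
                       r.+1 * r * (r.+1 + 1))); apply/eqP.
  transitivity (r.+1 * (r * (r.+1 + 1) + r.+1 * t1 + r * t2) + r ^ 2 * (r.+1 + 1) ^ 2)%N.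
    by ring.
  by rewrite -E1 -E2; ring.
have e1 : (t1 = (r.+1 ^ 2 + 1) * (r.+1 + 1) * r * r)%N.
  apply/eqP; rewrite -(eqn_pmul2l (isT : 0 < r.+1)%N).
  rewrite -(eqn_add2r (r * (r.+1 + 1) + r * t2)); apply/eqP.
  transitivity (r * (r.+1 + 1) + r.+1 * t1 + r * t2)%N; first by ring.
  by rewrite -E1 e2; ring.
apply/eqP; rewrite -(eqn_add2r (1 + t1 + t2)); apply/eqP.
transitivity (1 + t0 + t1 + t2)%N; first by ring.
by rewrite -E0 e1 e2; ring.
Qed.

(** The q - 1 nonzero multiples of one degree 0 vector exhaust the class counted by [card_deg0]. *)
Lemma nucleus_exists :
  exists2 n : V, n != 0 & forall x, x != 0 -> (deg x == 0%N) = (x \in <[n]>%VS).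
Proof.
have := card_deg0; set T := [set x | _] => cT.
have [n nT] : exists n, n \in T.
  by apply/set0Pn; rewrite -card_gt0 cT; have [k [_ ->]] := pE.
move: (nT); rewrite inE => /andP [n0 /eqP dn]; exists n => // x x0.
have sub : [set x in <[n]>%VS | x != 0] \subset T.
  apply/subsetP=> y; rewrite !inE => /andP [/vlineP [k ->] kn0].
  rewrite kn0 degZ ?dn //; apply: contraNneq kn0 => ->; by rewrite scale0r.
have c : #|[set x in <[n]>%VS | x != 0]| = q.-1.
  have : #|<[n]>%VS| = q by rewrite card_vspace dim_vline n0 expn1.
  rewrite (cardD1 (0 : V)) mem0v add1n => <-; rewrite /=.
  by apply: eq_card => y; rewrite !inE andbC.
have /eqP e : [set x in <[n]>%VS | x != 0] == T by rewrite eqEcard sub cT c /=.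
by move/setP/(_ x): e; rewrite !inE x0 andbT => ->.
Qed.

(** * The zero set and its intersection numbers *)

Section Nucleus.

Variable n : V.
Hypothesis n_neq0 : n != 0.
Hypothesis deg_eq0 : forall x, x != 0 -> (deg x == 0%N) = (x \in <[n]>%VS).

(** The points on (q^3 - q^2)/2 solids; the zero vector is added to make the set closed under all
    scalars. *)
Definition on_quadric x := (x == 0) || (deg x == q.-1 * (2 * p ^ 2) * q.-1)%N.

Lemma on_quadricZ a x : a != 0 -> on_quadric (a *: x) = on_quadric x.
Proof. by move=> a0; rewrite /on_quadric scaler_eq0 (negPf a0) degZ. Qed.

Lemma on_quadric_n x : on_quadric x -> x \in <[n]>%VS -> x = 0.
Proof.
have [//|x0] := eqVneq x 0; rewrite /on_quadric (negPf x0) /= => /eqP dx.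
by rewrite -deg_eq0 // dx; have [k [-> ->]] := pE.
Qed.

(** As [deg] has three values, it is an affine combination of the indicators of [on_quadric] and
    [<[n]>]; sums of degrees thus become counts of zeros. *)
Lemma deg_total x : x != 0 ->
  (deg x + q.-1 * (2 * p ^ 2) * on_quadric x +
   q.-1 * (2 * p ^ 2) * q * (x \in <[n]>%VS) = q.-1 * (2 * p ^ 2) * q)%N.
Proof.
move=> x0; rewrite -deg_eq0 // /on_quadric (negPf x0) /=.
have q0 : (0 < q.-1)%N by lia.
have u0 : (0 < q.-1 * (2 * p ^ 2))%N by rewrite !muln_gt0 q0 /= (ltnW p_gt1).
have qr : (q = q.-1 + 1)%N by lia.
have qr' : (q == q.-1) = false by apply/eqP; lia.
case: (deg_cases x0) => ->.
- rewrite eqxx eq_sym muln_eq0 (gtn_eqF u0) (gtn_eqF q0) /=; lia.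
- by rewrite eqn_pmul2l // qr' muln_eq0 (gtn_eqF u0) (gtn_eqF (q_gt0 F)) /= !muln0 !addn0.
- by rewrite eqxx muln_eq0 (gtn_eqF u0) (gtn_eqF q0) /= muln1 muln0 addn0 -[X in (_ + X)%N]muln1 -mulnDr -qr.
Qed.

Lemma sum_deg_total X :
  (\sum_(x in X | x != 0%R) deg x +
   q.-1 * (2 * p ^ 2) * #|[set x in X | on_quadric x]| +
   q.-1 * (2 * p ^ 2) * q * #|[set x in X | x \in <[n]>%VS]| =
   q.-1 * (2 * p ^ 2) * q * #|X| + q.-1 * (2 * p ^ 2))%N.
Proof.
set u := (q.-1 * (2 * p ^ 2))%N.
(* The zero vector is split off: it satisfies the predicates but is omitted from the sums. *)
have h (P : pred V) : P 0 -> (#|[set x in X | P x]| = \sum_(x in X | x != 0%R) P x + 1)%N.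
  move=> P0; rewrite -sum1_card (bigD1 (0 : V)) ?inE ?mem0v //= addnC; congr (_ + _)%N.
  rewrite -big_mkcondr /=; apply: eq_bigl => x; rewrite !inE -!andbA; congr (_ && _).
  exact: andbC.
have on0 : on_quadric 0 by rewrite /on_quadric eqxx.
rewrite (h on_quadric on0) (h (fun x => x \in <[n]>%VS)) ?mem0v //.
have -> : (#|X| = \sum_(x in X | x != 0%R) 1 + 1)%N.
  by rewrite -(h xpredT) // -cardsE; apply: eq_card => x; rewrite !inE andbT.
have e : (\sum_(x in X | x != 0%R) deg x +
    u * (\sum_(x in X | x != 0%R) on_quadric x) +
    u * q * (\sum_(x in X | x != 0%R) (x \in <[n]>%VS)) =
    u * q * (\sum_(x in X | x != 0%R) 1))%N.
  rewrite !big_distrr -!big_split; apply: eq_bigr => x /andP [_ x0] /=.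
  by rewrite muln1 (deg_total x0).
by rewrite !mulnDr !muln1 -e; ring.
Qed.

Definition zeros X := #|[set x in X | on_quadric x]|.

(** Eliminating the sum of degrees between [sum_deg0] and [sum_deg_total] relates the zeros in [X]
    to the elements of [D] orthogonal to [X]. *)
Lemma zeros_notin X : n \notin X ->
  (q * p * #|X| + q.-1 * q ^ 3 * p = #|X| * numin (ann X) + q ^ 2 * p * zeros X)%N.
Proof.
move=> nX; have := sum_deg_total X; have := sum_deg0 X.
have -> : #|[set x in X | x \in <[n]>%VS]| = 1%N.
  rewrite -[RHS](cards1 (0 : V)); apply: eq_card => x; rewrite !inE.
  apply/andP/eqP=> [[xX /vlineP [k xk]] | ->]; last by rewrite !mem0v.
  have [k0|k0] := eqVneq k 0; first by rewrite xk k0 scale0r.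
  by case/negP: nX; rewrite -[n](scalerK k0) -xk memvZ.
rewrite card_D -/(zeros X); move: (\sum_(x in X | _) _)%N (numin _) (zeros X) #|X| => S m z c.
have u2 : (2 * p ^ 2 = q * p)%N by rewrite qE; ring.
rewrite u2; have q0 : (0 < q.-1)%N by lia.
have : q = q.-1.+1 by lia.
move: q q.-1 q0 => Q r r0 -> E1 E2.
apply/eqP; rewrite -(eqn_pmul2l r0).
rewrite -(eqn_add2l (r.+1 * S + r.+1 * (r * (r.+1 * p) * (r * (r.+1 + 1))))); apply/eqP.
rewrite [in LHS]E1.
transitivity (r * c * m + r.+1 * (r * (r.+1 * p) * r.+1 * c + r * (r.+1 * p)) +
  r.+1 * (r * (r.+1 * p) * (r * (r.+1 + 1))) - r * (r.+1 * p) * r.+1 * r.+1)%N.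
  apply/esym/(canLR (addnK _)); ring.
rewrite -E2; apply/(canLR (addnK _)); ring.
Qed.

(** The same elimination; here no element of [D] is orthogonal to [X], since none is orthogonal to
    [n]. *)
Lemma zeros_in X : n \in X -> (q * zeros X = #|X|)%N.
Proof.
move=> nX; have := sum_deg_total X; have := sum_deg0 X.
have -> : #|[set x in X | x \in <[n]>%VS]| = q.
  transitivity #|<[n]>%VS|; last by rewrite card_vspace dim_vline n_neq0 expn1.
  apply: eq_card => x; rewrite !inE; apply: andb_idl => /vlineP [k ->].
  exact: memvZ.
have -> : numin (ann X) = 0%N.
  have /eqP : deg n = 0%N by apply/eqP; rewrite deg_eq0 // memv_line.
  rewrite cards_eq0 => /eqP dn; apply/eqP; rewrite cards_eq0; apply/eqP/setP=> w.
  rewrite !inE; apply/negP => /andP [wD /annP wX].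
  by have := in_set0 w; rewrite -dn !inE wD wX ?eqxx.
rewrite card_D -/(zeros X); move: (\sum_(x in X | _) _)%N (zeros X) #|X| => S z c.
have : (0 < q.-1 * (2 * p ^ 2))%N by rewrite !muln_gt0; apply/and4P; split; lia.
have : q = q.-1.+1 by lia.
move: (2 * p ^ 2)%N q q.-1 => u Q r -> u0 E1 E2.
apply/eqP; rewrite -(eqn_pmul2l u0).
rewrite -(eqn_add2l (r.+1 * S + r.+1 * (r * u * (r * (r.+1 + 1))))); apply/eqP.
rewrite [in RHS]E1.
transitivity (r.+1 * (S + r * u * z + r * u * r.+1 * r.+1) +
  r.+1 * (r * u * (r * (r.+1 + 1))) - r * u * r.+1 ^ 3)%N.
  apply/esym/(canLR (addnK _)); ring.
rewrite E2; apply/(canLR (addnK _)); ring.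
Qed.

(** For [x] off [<[n]>], [zeros_in] leaves q zeros in the span of [n] and [x]: a single point, which
    differs from [<[n]>]. *)
Lemma on_quadric_unique x : exists t, forall s, on_quadric (x + s *: n) = (s == t).
Proof.
have [/vlineP [c ->] | xn] := boolP (x \in <[n]>%VS).
  exists (- c) => s; rewrite -scalerDl -addr_eq0 addrC.
  have [->|cs] := eqVneq (s + c) 0; first by rewrite scale0r /on_quadric eqxx.
  apply/negP => /on_quadric_n; rewrite memvZ ?memv_line // => /(_ isT) /eqP.
  by rewrite scaler_eq0 (negPf cs) (negPf n_neq0).
set X := (<[n]> + <[x]>)%VS.
have nX : n \in X by rewrite (subvP (addvSl _ _)) ?memv_line.
have xX : x \in X by apply: memv_add_line.
have zX : zeros X = q.
  have := zeros_in nX; rewrite card_vspace dim_add_lines // => /eqP.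
  by rewrite eqn_pmul2l ?q_gt0 // => /eqP.
have [y] : exists y, y \in [set y in X | on_quadric y] :\ 0.
  apply/set0Pn; rewrite -card_gt0; have := cardsD1 (0 : V) [set y in X | on_quadric y].
  by rewrite -/(zeros X) zX qE; case: (_ \in _) => /=; move: #|_ :\ _| => m; lia.
rewrite !inE => /and3P [y0 /add_lineP [s [t yE]] Oy].
have t0 : t != 0.
  apply: contraNneq y0 => t0; apply/eqP/on_quadric_n => //.
  by rewrite yE t0 scale0r addr0 memvZ ?memv_line.
have Ox : on_quadric (x + (t^-1 * s) *: n).
  by rewrite -(on_quadricZ _ t0) scalerDr scalerA mulVKf // addrC -yE.
exists (t^-1 * s) => s'; apply/idP/eqP=> [Os' | ->//].
apply/eqP/negPn/negP => ss'; have: (zeros X <= q)%N by rewrite zX.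
rewrite leqNgt; case/negP; move: (t^-1 * s) Ox ss' => {y0 yE t0 Oy t} t Ox ss' {s y}.
pose z := x + t *: n; have z0 : z != 0.
  by apply: contraNneq xn => /eqP; rewrite addr_eq0 => /eqP ->; rewrite memvN memvZ ?memv_line.
have inj : injective (fun a : F => a *: z).
  move=> a b /eqP; rewrite -subr_eq0 -scalerBl scaler_eq0 (negPf z0) orbF.
  by rewrite subr_eq0 => /eqP.
(* A second zero x + s'n would add one vector to the q multiples of [z]. *)
have -> : q.+1 = #|(x + s' *: n) |: [set a *: z | a : F]|.
  rewrite cardsU1 card_imset // (_ : _ \notin _ = true) //.
  apply/imsetP=> [[a _ e]].
  have : (1 - a) *: x = (a * t - s') *: n.
    rewrite !scalerBl scale1r -scalerA; apply/eqP; rewrite subr_eq addrAC eq_sym subr_eq.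
    by rewrite addrC -scalerDr addrC [X in a *: X]addrC -/z -e addrC.
  have [a1 | a1] := eqVneq (1 - a) 0.
    rewrite a1 scale0r => /esym /eqP; rewrite scaler_eq0 (negPf n_neq0) orbF subr_eq0.
    by move: a1 => /eqP; rewrite subr_eq0 => /eqP <-; rewrite mul1r eq_sym (negPf ss').
  by move=> e2; case/negP: xn; rewrite -[x](scalerK a1) e2 !memvZ ?memv_line.
apply/subset_leq_card/subsetP=> y; rewrite !inE => /predU1P [-> | /imsetP [a _ ->]].
  by rewrite memvD ?memvZ.
rewrite memvZ ?memvD ?memvZ //=; have [->|a0] := eqVneq a 0.
  by rewrite scale0r /on_quadric eqxx.
by rewrite on_quadricZ.
Qed.

Lemma n_elliptic w : w \in D -> dot w n != 0.
Proof.
move=> wD; have /eqP : deg n = 0%N by apply/eqP; rewrite deg_eq0 // memv_line.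
rewrite cards_eq0 => /eqP dn; apply/negP=> wn.
by have := in_set0 w; rewrite -dn !inE wD wn.
Qed.

(** The dual plane [ann X] meets [D], so [numin_plane_ge] bounds the zeros by q^2 - (q - 1)^2 = 2q -
    1. *)
Lemma zeros_line_elliptic X w : \dim X = 2%N -> w \in D -> w \in ann X ->
  (zeros X < 2 * q)%N.
Proof.
move=> dX wD wX; have nX : n \notin X.
  by apply/negP=> nX; have := n_elliptic wD; rewrite (annP _ _ wX) ?eqxx.
have dA : \dim (ann X) = 3%N by rewrite dim_ann dX.
have := numin_plane_ge dA wD wX; have := zeros_notin nX; rewrite card_vspace dX.
move: (numin _) (zeros X) => m z.
have : q = q.-1.+1 by rewrite prednK ?q_gt0.
have : (0 < p)%N by lia.
move: q q.-1 => Q r p0 -> e le.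
have {}e : (p * r.+1 ^ 2 = m + p * z)%N.
  apply/eqP; rewrite -(eqn_pmul2l (isT : 0 < r.+1 ^ 2)%N); apply/eqP.
  by rewrite mulnDr [X in (_ + X)%N]mulnA -e; ring.
rewrite -(ltn_pmul2l p0) -(ltn_add2l (p * r ^ 2)).
apply: (@leq_ltn_trans (p * r.+1 ^ 2)).
  by rewrite e leq_add2r; apply: leq_trans le; apply: eq_leq; ring.
rewrite -mulnDr ltn_pmul2l // -!mulnn; lia.
Qed.

Lemma zeros_line X : \dim X = 2%N -> n \notin X ->
  zeros X = (q ^ 2)%N \/ (zeros X < 2 * q)%N.
Proof.
move=> dX nX; case: (set_0Vmem [set w in D | w \in ann X]) => [e0|[w]]; last first.
  by rewrite inE => /andP [wD wX]; right; apply: zeros_line_elliptic wX.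
left; have := zeros_notin nX; rewrite card_vspace dX /numin e0 cards0 muln0 add0n.
have : q = q.-1.+1 by rewrite prednK ?q_gt0.
have : (0 < p)%N by lia.
move: (zeros X) q q.-1 => z Q r p0 -> e.
apply/eqP; rewrite -(eqn_pmul2l p0) -(eqn_pmul2l (isT : 0 < r.+1 ^ 2)%N); apply/eqP.
by rewrite [LHS]mulnA -e; ring.
Qed.

(** The three values of [numin_line] on [ann X] correspond to 2q^2 - q, q^2 and q zeros, in this
    order. *)
Lemma zeros_plane X : \dim X = 3%N -> n \notin X ->
  (zeros X <= q ^ 2)%N \/ zeros X = (2 * q ^ 2 - q)%N.
Proof.
move=> dX nX; have dA : \dim (ann X) = 2%N by rewrite dim_ann dX.
have := zeros_notin nX; rewrite card_vspace dX.
have p0 : (0 < p)%N by lia.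
have qr : q = q.-1.+1 by rewrite prednK ?q_gt0.
have E : (q * p * q ^ 3 + q.-1 * q ^ 3 * p = q ^ 2 * (p * (2 * q ^ 2 - q)))%N.
  have -> : (2 * q ^ 2 - q = q * (q + q.-1))%N.
    by move: q qr => Q ->; move: Q.-1 => r; apply/(canLR (addnK _)); ring.
  ring.
have q20 : (0 < q ^ 2)%N by rewrite expn_gt0 q_gt0.
rewrite E; case: (numin_line dA) => ->; move=> e.
- right; apply/eqP; rewrite -(eqn_pmul2l p0) -(eqn_pmul2l q20); apply/eqP.
  by rewrite e; ring.
- left; rewrite -(leq_pmul2l p0) -(leq_pmul2l q20).
  have e2 : (q ^ 2 * (p * (2 * q ^ 2 - q)) = q ^ 3 * (q.-1 * p) + q ^ 2 * (p * q ^ 2))%N.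
    by rewrite -E; ring.
  move: e; rewrite e2 -[(q ^ 2 * p * _)%N]mulnA => /addnI ->; exact: leqnn.
- left; rewrite -(leq_pmul2l p0) -(leq_pmul2l q20).
  have e2 : (q ^ 2 * (p * (2 * q ^ 2 - q)) = q ^ 3 * (q.-1 * p) + q ^ 2 * (p * q ^ 2))%N.
    by rewrite -E; ring.
  move: e; rewrite e2 -[(q ^ 2 * p * _)%N]mulnA => e.
  rewrite -(leq_add2l (q ^ 3 * (q.-1 * p))) e leq_add2r leq_mul2l leq_mul2l.
  by rewrite (_ : p <= q)%N ?orbT // qE; lia.
Qed.

Lemma zeros_elliptic w : w \in D -> zeros (ann <[w]>) = (q ^ 3 - q * q.-1)%N.
Proof.
move=> wD; have nX : n \notin ann <[w]> by rewrite ann_line n_elliptic.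
have := zeros_notin nX; rewrite annK numin_point // card_vspace dim_ann.
rewrite dim_vline D_neq0 // -[(5 - true)%N]/4%N.
have p0 : (0 < p)%N by lia.
have qr : q = q.-1.+1 by rewrite prednK ?q_gt0.
have -> : (q ^ 3 - q * q.-1 = q ^ 2 * q.-1 + q)%N.
  by move: q qr => Q ->; move: Q.-1 => r; apply/(canLR (addnK _)); rewrite [r.+1.-1]/=; ring.
move: (zeros _) => z e.
have q20 : (0 < q ^ 2)%N by rewrite expn_gt0 q_gt0.
apply/eqP; rewrite -(eqn_pmul2l p0) -(eqn_pmul2l q20).
rewrite -(eqn_add2l (q ^ 4 * q.-1)) mulnA -e; apply/eqP.
have e4 : (q ^ 4 * q.-1 = q ^ 3 * q.-1 * (2 * p))%N by rewrite -qE; ring.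
by rewrite e4; move: q qr => Q ->; move: Q.-1 => r; rewrite [r.+1.-1]/=; ring.
Qed.

(** There are exactly q^3 zeros if the solid contains [n], and otherwise even more by [zeros_notin].
    The bound separates these solids from those carrying an elliptic form. *)
Lemma zeros_nonelliptic w : w != 0 -> w \notin D -> (q ^ 3 <= zeros (ann <[w]>))%N.
Proof.
move=> w0 wD; have cX : #|ann <[w]>| = (q ^ 4)%N by rewrite card_vspace dim_ann dim_vline w0.
have [nX|nX] := boolP (n \in ann <[w]>).
  by have := zeros_in nX; rewrite cX expnS => /eqP; rewrite eqn_pmul2l ?q_gt0 // => /eqP ->.
have := zeros_notin nX; rewrite annK cX.
have -> : numin <[w]> = 0%N.
  apply/eqP; rewrite cards_eq0; apply/eqP/setP=> v; rewrite !inE.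
  apply/negP=> /andP [vD /vlineP [k vk]].
  have k0 : k != 0 by apply: contraTneq vD => k0; rewrite vk k0 scale0r.
  by case/negP: wD; rewrite -[w](scalerK k0) -vk DZ // invr_eq0.
rewrite muln0 add0n; move: (zeros _) => z e.
have p0 : (0 < p)%N by lia.
have q20 : (0 < q ^ 2 * p)%N by rewrite muln_gt0 expn_gt0 q_gt0.
rewrite -(leq_pmul2l q20) -e; apply: leq_trans (leq_addr _ _).
by apply: eq_leq; ring.
Qed.

End Nucleus.

Lemma dual_quadric : 2%N \in [pchar F] -> exists Q : V -> F,
  [/\ quadratic_form Q, nonsingular Q,
      forall w, w \in D -> elliptic_form_on (ann <[w]>) Q &
      forall w, w != 0 -> w \notin D ->
        (q ^ 3 <= #|[set x in ann <[w]> | Q x == 0%R]|)%N].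
Proof.
move=> char2; have [n n0 dn] := nucleus_exists.
have uniq := on_quadric_unique n0 dn.
(* The default 0 is never taken, by [on_quadric_unique]. *)
pose phi x := odflt 0 [pick t | on_quadric (x + t *: n)].
have phiP s x : on_quadric (x + s *: n) = (s == phi x).
  have [t tP] := uniq x; rewrite tP; congr (s == _); rewrite /phi.
  by case: pickP => [r|/(_ t)] /=; rewrite tP ?eqxx // => /eqP.
have on0 x : on_quadric x = (phi x == 0).
  by rewrite -[x in LHS]addr0 -(scale0r n) phiP eq_sym.
(* From x + sn the remaining distance to the zero is phi(x) - s, which is phi(x) + s in
   characteristic 2. *)
have phi_shift s x : phi (x + s *: n) = phi x + s.
  apply/esym/eqP; rewrite -phiP -addrA -scalerDl addrCA addrr_pchar2 // addr0.
  by rewrite phiP.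
have phiZ s x : phi (s *: x) = s * phi x.
  have [->|s0] := eqVneq s 0.
    by rewrite scale0r mul0r; apply/eqP; rewrite -on0 /on_quadric eqxx.
  by apply/esym/eqP; rewrite -phiP -scalerA -scalerDr on_quadricZ // phiP.
have zE X : isotropics phi X = zeros X.
  by apply: eq_card => x; rewrite !inE on0.
have q2 : (2 < q)%N by lia.
have hline X : \dim X = 2%N -> n \notin X ->
    isotropics phi X = (q ^ 2)%N \/ (isotropics phi X < 2 * q)%N.
  by rewrite zE; apply: zeros_line dn _.
have hplane X : \dim X = 3%N -> n \notin X ->
    (isotropics phi X <= q ^ 2)%N \/ isotropics phi X = (2 * q ^ 2 - q)%N.
  by rewrite zE; apply: zeros_plane dn _.
have hell w : w \in D -> isotropics phi (ann <[w]>) = (q ^ 3 - q * q.-1)%N.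
  by rewrite zE; apply: zeros_elliptic dn _.
have hn w : w \in D -> dot w n != 0 by apply: n_elliptic dn _.
have hell_line w X : w \in D -> \dim X = 2%N -> (X <= ann <[w]>)%VS ->
    (isotropics phi X < 2 * q)%N.
  rewrite zE sub_ann_line => wD dX wX; exact: (zeros_line_elliptic n0 dn dX wD wX).
have hex x : x != 0 -> phi x = 0 -> exists2 w, w \in D & dot w x = 0.
  move=> x0 /eqP; rewrite -on0 /on_quadric (negPf x0) /= => /eqP dx.
  have [w] : exists w, w \in [set w in D | dot w x == 0].
    apply/set0Pn; rewrite -card_gt0 -/(deg x) dx.
    by have [k [-> ->]] := pE.
  by rewrite inE => /andP [wD /eqP wx]; exists w.
exists (phi_form phi); split.
- exact: (form_quadratic q2 phiZ phi_shift hline hplane hell hn hell_line hex char2).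
- exact: (form_nonsingular q2 phiZ phi_shift hline hplane hell hn hell_line hex char2).
- move=> w wD.
  exact: (elliptic_form q2 phiZ phi_shift hline hplane hell hn hell_line hex char2 wD).
- move=> w w0 wD; apply: leq_trans (zeros_nonelliptic n0 dn w0 wD) _.
  by apply: eq_leq; apply: eq_card => x; rewrite !inE on0 /phi_form sqrf_eq0.
Qed.

End Plane.

End DualSet.

(** * Zeros of elliptic forms, and the characteristic *)

Lemma irreducible_quadratic_anisotropic (F : fieldType) (a b c x y : F) :
  a != 0 -> irreducible_poly (a *: 'X^2 + b *: 'X + c%:P) ->
  a * x ^+ 2 + b * (x * y) + c * y ^+ 2 = 0 -> x = 0 /\ y = 0.
Proof.
move=> a0 [_ irr] e.
have y0 : y = 0.
  (* With y != 0 the quotient x/y would be a root, giving a linear factor of an irreducible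
     polynomial of degree 2. *)
  apply/eqP/negPn/negP=> y0; set P := _ + _ in irr.
  have sz : size P = 3%N.
    rewrite /P -addrA size_polyDl size_scale ?size_polyXn //.
    apply: leq_ltn_trans (size_polyD _ _) _.
    rewrite gtn_max (leq_ltn_trans (size_scale_leq _ _)) ?size_polyX //=.
    by rewrite (leq_ltn_trans (size_polyC_leq1 _)).
  have /eqp_size : ('X - (x / y)%:P) %= P.
    apply: irr; first by rewrite size_XsubC.
    rewrite dvdp_XsubCl /root /P !hornerD !hornerZ hornerXn hornerX hornerC.
    rewrite (_ : _ + _ = (a * x ^+ 2 + b * (x * y) + c * y ^+ 2) / y ^+ 2); last by field.
    by rewrite e mul0r.
  by rewrite size_XsubC sz.
split=> //; move/eqP: e; rewrite y0 mulr0 expr0n /= !mulr0 !addr0.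
by rewrite mulf_eq0 (negPf a0) sqrf_eq0 => /eqP.
Qed.

(* A zero with x2 != 0 is determined by (x0, x1, x2), and one with x2 = 0 by
   x3; so the zeros are covered by F ^ 3, with 0 covered more than once. *)
Lemma elliptic_form_zeros (F : finFieldType) m (Y : {vspace 'rV[F]_m}) Q' :
  elliptic_form_on Y Q' -> (#|[set x in Y | Q' x == 0%R]| < #|F| ^ 3)%N.
Proof.
move=> [e [a [b [c [be a0 irr Qe]]]]].
pose f (z : F * F * F) := let: (x0, x1, x2) := z in
  if x2 == 0 then x0 *: e`_3 else
  x0 *: e`_0 + x1 *: e`_1 + x2 *: e`_2 +
  (- (a * x0 ^+ 2 + b * (x0 * x1) + c * x1 ^+ 2) / x2) *: e`_3.
have sub : [set x in Y | Q' x == 0] \subset f @: (setT :\ (0, 1, 0)).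
  apply/subsetP=> x; rewrite inE => /andP [xY].
  have := coord_basis be xY; rewrite !big_ord_recl big_ord0 addr0 /= /bump /=.
  set x0 := coord _ _ _; set x1 := coord _ _ _; set x2 := coord _ _ _; set x3 := coord _ _ _.
  rewrite !addrA => -> /eqP; rewrite Qe => e0.
  have [x20|x20] := eqVneq x2 0.
    move: e0; rewrite x20 mul0r addr0 => /(irreducible_quadratic_anisotropic a0 irr) [-> ->].
    apply/imsetP; exists (x3, 0, 0); last by rewrite /f eqxx !scale0r !add0r.
    by rewrite !inE !xpair_eqE (eq_sym 0) oner_eq0 andbF.
  apply/imsetP; exists (x0, x1, x2); first by rewrite !inE !xpair_eqE (negPf x20) andbF.
  rewrite /f (negPf x20); congr (_ + _ *: _).
  apply: (mulfI x20); rewrite mulrCA mulfV // mulr1; apply/eqP.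
  by rewrite -addr_eq0 addrC; apply/eqP.
apply: leq_ltn_trans (subset_leq_card sub) _; apply: leq_ltn_trans (leq_imset_card _ _) _.
rewrite (_ : _ ^ 3 = #|[set: F * F * F]|)%N; last by rewrite cardsT !card_prod expnSr expnSr expn1.
by apply: proper_card; rewrite properD1 ?inE.
Qed.

(** By Cauchy's theorem the additive group has an element of order 2. *)
Lemma pchar2_even (F : finFieldType) : ~~ odd #|F| -> 2%N \in [pchar F].
Proof.
rewrite -dvdn2 -cardsT => d2.
have [x _ o2] := @Cauchy F 2%N [set: F]%G isT d2. have x0 : x != 0.
  by apply/eqP=> x0; move: o2; rewrite x0 order1.
have /eqP : 2%:R * x = 0 :> F.
  by rewrite mulr_natl; have := expg_order x; rewrite o2.
rewrite mulf_eq0 => /orP [h | /eqP e]; last by case/eqP: x0.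
by apply/andP.
Qed.

(** * From solids to the dual set *)

Section Dualize.

Variables (F : finFieldType) (E : {fset {vspace 'rV[F]_5}}).
Notation V := 'rV[F]_5.
Notation q := #|F|.

Hypothesis E_solids : forall S : {vspace V}, S \in E -> is_solid S.

Definition dual_set := [set w : V | (w != 0%R) && (ann <[w]>%VS \in E)].

Lemma dual_set0 : 0 \notin dual_set.
Proof. by rewrite inE eqxx. Qed.

Lemma vlineZ (a : F) (w : V) : a != 0 -> (<[a *: w]> = <[w]>)%VS.
Proof.
move=> a0; apply/eqP; rewrite eqEsubv -!memvE memvZ ?memv_line //=.
by rewrite -[w in w \in _](scalerK a0) memvZ ?memv_line.
Qed.

Lemma dual_setZ (a : F) (w : V) : a != 0 -> w \in dual_set -> a *: w \in dual_set.
Proof. by move=> a0; rewrite !inE vlineZ // scaler_eq0 (negPf a0). Qed.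

(** Each solid of [E] is the orthogonal of q - 1 nonzero vectors, and these lie in [ann U] exactly
    when the solid contains [U]. *)
Lemma numin_dual_set (U : {vspace V}) :
  numin dual_set (ann U) = (q.-1 * num_through E U)%N.
Proof.
set T := [fset S in E | (U <= S)%VS]%fset.
have TE S : (S \in T) = (S \in E) && (U <= S)%VS by rewrite !inE.
set A := [set w in dual_set | w \in ann U].
have AE w : (w \in A) = (w != 0) && (ann <[w]> \in T).
  by rewrite TE sub_ann_line andbA !inE.
rewrite /numin -/A -sum1_card.
have -> : (\sum_(w in A) 1 = \sum_(w in A) \sum_(S <- T) (ann <[w]>%VS == S))%N.
  apply: eq_bigr => w; rewrite AE => /andP [_ wT].
  rewrite -big_mkcond sum1_count /= (_ : count _ _ = count_mem (ann <[w]>%VS) T).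
    by rewrite count_uniq_mem ?fset_uniq // wT.
  by apply: eq_count => S; rewrite /= eq_sym.
rewrite exchange_big /= big_seq (eq_bigr (fun _ => q.-1)) => [|S]; last first.
  rewrite TE => /andP [SE US]; have dS : \dim (ann S) = 1%N.
    by rewrite dim_ann (eqP (E_solids SE)).
  have -> : q.-1 = #|[set w in ann S] :\ 0%R|.
    have := cardsD1 (0 : V) [set w in ann S].
    by rewrite inE mem0v cardsE card_vspace dS expn1 add1n => ->.
  rewrite -sum1_card -big_mkcondr /=; apply: eq_bigl => w.
  rewrite AE !inE -andbA; case: eqVneq => //= w0; apply/andP/idP=> [[_ /eqP <-] | wS].
    by rewrite annK memv_line.
  have eS : ann <[w]> = S.
    rewrite -[RHS]annK; congr (ann _); apply/eqP.
    by rewrite eqEdim -memvE wS dS dim_vline w0.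
  by rewrite eS SE US eqxx.
by rewrite -big_seq big_const_seq count_predT iter_addn_0 mulnC /num_through.
Qed.

End Dualize.

(** * Points of the quadric, and the passage back to solids *)

Lemma isotropic_quadric (F : fieldType) (V : vectType F) (Q : V -> F) x :
    (forall a, Q (a *: x) = a ^+ 2 * Q x) -> x != 0 ->
  quadric Q <[x]>%VS <-> Q x = 0.
Proof.
move=> QZ x0; split=> [[_ h] | Qx]; first by apply: h; rewrite memv_line.
split; first by rewrite /is_point dim_vline x0.
by move=> v /vlineP [k ->]; rewrite QZ Qx mulr0.
Qed.

Theorem theorem1p2 (q : nat) (F : finFieldType) (cardF : #|F| = q)
    (q_gt2 : (2 < q)%N) (q_even : ~~ odd q)
    (E : {fset {vspace 'rV[F]_5}})
    (E_solids : forall S : {vspace 'rV[F]_5}, S \in E -> is_solid S)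
    (I : forall P : {vspace 'rV[F]_5}, is_point P ->
      num_through E P \in [:: 0; q ^ 3 %/ 2; (q ^ 3 - q ^ 2) %/ 2]%N)
    (II : forall A : {vspace 'rV[F]_5}, is_plane A ->
      num_through E A \in [:: 0; q %/ 2; q]%N)
    (III : exists L : {vspace 'rV[F]_5},
      is_line L /\ num_through E L = (q * (q + 1) %/ 2)%N) :
  exists Q : 'rV[F]_5 -> F,
    [/\ quadratic_form Q, nonsingular Q &
        forall S : {vspace 'rV[F]_5},
          S \in E <-> is_solid S /\ meets_in_elliptic_quadric S Q].
Proof.
pose p := q./2; have qE : q = (2 * p)%N by rewrite mul2n even_halfK.
have FE : #|F| = (2 * p)%N by rewrite cardF.
have p_gt1 : (1 < p)%N by lia.
have deg_cases x : x != 0 ->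
    [\/ deg (dual_set E) x = 0, deg (dual_set E) x = #|F|.-1 * (2 * p ^ 2) * #|F| |
      deg (dual_set E) x = #|F|.-1 * (2 * p ^ 2) * #|F|.-1]%N.
  move=> x0; rewrite -numin_ann_line numin_dual_set //.
  have : is_point <[x]> by rewrite /is_point dim_vline x0.
  move/I; rewrite !inE => /or3P [] /eqP ->; first by constructor 1; rewrite muln0.
    constructor 2; rewrite -mulnA; congr (_ * _)%N; rewrite FE qE.
    by rewrite (_ : (2 * p) ^ 3 = (2 * p ^ 2 * (2 * p)) * 2)%N ?mulnK //; ring.
  constructor 3; rewrite -mulnA; congr (_ * _)%N; rewrite FE qE.
  rewrite (_ : (2 * p) ^ 3 - (2 * p) ^ 2 = (2 * p ^ 2 * (2 * p).-1) * 2)%N ?mulnK //.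
  by rewrite expnSr -[X in (_ - X)%N]muln1 -mulnBr subn1; ring.
have numin_line (Y : {vspace 'rV[F]_5}) : \dim Y = 2%N ->
    [\/ numin (dual_set E) Y = 0, numin (dual_set E) Y = #|F|.-1 * p |
      numin (dual_set E) Y = #|F|.-1 * #|F|]%N.
  move=> dY; rewrite -(annK Y) numin_dual_set //.
  have : is_plane (ann Y) by rewrite /is_plane dim_ann dY.
  move/II; rewrite !inE => /or3P [] /eqP ->; first by constructor 1; rewrite muln0.
    by constructor 2; rewrite qE mulKn.
  by constructor 3; rewrite cardF.
have [L [/eqP dL nL]] := III.
(* The line of (III) becomes the plane [Pi] of the dual space. *)
have dPi : \dim (ann L) = 3%N by rewrite dim_ann dL.
have nPi : numin (dual_set E) (ann L) = (#|F|.-1 * (p * (#|F| + 1)))%N.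
  by rewrite numin_dual_set // nL FE qE -mulnA mulKn.
have char2 : 2%N \in [pchar F] by apply: pchar2_even; rewrite cardF.
have [Q [Qq Qn Qell Qnell]] := dual_quadric FE p_gt1 (dual_set0 E)
  (@dual_setZ _ E) deg_cases numin_line dPi nPi char2.
exists Q; split=> // S; split=> [SE | [/eqP dS [Q' [Q'e QQ']]]].
  have sS := E_solids _ SE; split=> //.
  have [w wS w0] : exists2 w, w \in ann S & w \notin (0 : {vspace 'rV[F]_5})%VS.
    by apply: ex_notin; rewrite dim_ann (eqP sS) dimv0.
  rewrite memv0 in w0.
  have eS : ann <[w]> = S.
    rewrite -[RHS]annK; congr (ann _); apply/eqP.
    by rewrite eqEdim -memvE wS dim_ann (eqP sS) dim_vline w0.
  by exists Q; split=> //; rewrite -eS; apply: Qell; rewrite inE w0 eS.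
have [w wS w0] : exists2 w, w \in ann S & w \notin (0 : {vspace 'rV[F]_5})%VS.
  by apply: ex_notin; rewrite dim_ann dS dimv0.
rewrite memv0 in w0.
have eS : ann <[w]> = S.
  rewrite -[RHS]annK; congr (ann _); apply/eqP.
  by rewrite eqEdim -memvE wS dim_ann dS dim_vline w0.
(* [Q'] shares with [Q] only its points in [S], not its values, so zeros are compared: at least q^3
   for a solid outside [E], fewer for an elliptic form. *)
apply/negPn/negP => SE.
have : (#|F| ^ 3 <= #|[set x in S | Q x == 0%R]|)%N.
  by rewrite -eS; apply: Qnell => //; rewrite inE w0 eS.
rewrite leqNgt; case/negP; apply: leq_ltn_trans (elliptic_form_zeros Q'e).
apply/subset_leq_card/subsetP=> x; rewrite !inE => /andP [xS /eqP Qx]; rewrite xS /=.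
(* [quadric] speaks of points only, so the zero vector is handled apart, through zero
   coordinates. *)
have [x0|x0] := eqVneq x 0; last first.
  have /QQ' [[_ h] _] : quadric Q <[x]>%VS /\ (<[x]> <= S)%VS.
    split; last by rewrite -memvE.
    by apply/isotropic_quadric => // a; apply: Qq.1.
  by rewrite h ?memv_line.
case: Q'e => e [a [b [c [_ _ _ Qe]]]].
by have := Qe 0 0 0 0; rewrite !scale0r !addr0 x0 !expr0n /= !mulr0 !addr0 => ->.
Qed.
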